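(* Let $K$ and $K'$ be any two oriented, non-split alternating links in $S^3$, and let $K\#K'$ denote the connect sum along any component of $K$ and any component of $K'$. Then $$P_{K\#K'}=P_K\,P_{K'},$$ where $P$ is the polynomial invariant of alternating links defined in the context.
   Context: All links are oriented and non-split. A link is alternating if it has a diagram in which each component alternates between over- and undercrossings (an alternating diagram). Crossing signs: rotate the picture so both strands point upward; the crossing is positive if the overstrand runs from lower left to upper right, negative if it runs from lower right to upper left. Tait digraph. Let $D\subset\mathbb{R}^2$ be an alternating diagram of a non-split link. Regions of $D$ are the components of the complement of the underlying 4-valent plane graph. Choose the checkerboard shading of the regions such that at every crossing, when the picture is rotated so that the overstrand runs from lower left to upper right, the top and bottom regions are the shaded ones. The Tait digraph $G=(V,E)$ is the plane digraph with one vertex in each shaded region and one edge through each crossing, joining the vertices of the two shaded regions at that crossing (loops and multiple edges allowed), directed to match the overcrossing: rotating so that the overstrand is directed from lower left to upper right, the edge points from the bottom region to the top region. An edge is positive or negative according to the sign of its crossing; $E=E_+\sqcup E_-$. Activities. Fix a root vertex $r\in V$ and a basepoint $q\in\mathbb{R}^2\setminus G$. Let $T$ be a spanning tree of $G$ (viewed as a set of edges). An edge $e\in T$ is internally semi-active if it points away from the component of $T\setminus\{e\}$ containing $r$, and internally semi-passive otherwise. For $e\in E\setminus T$, let $\mathrm{Cyc}_T(e)$ be the unique cycle in $T\cup\{e\}$, oriented counter-clockwise around $q$ in $\mathbb{R}^2\cup\{\infty\}$ (so that the side containing $q$ lies on its left); $e$ is externally semi-active if its direction agrees with this orientation, and externally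 semi-passive otherwise. Let $\iota_+(T)$, $\overline{\iota}_+(T)$ be the numbers of internally semi-active, respectively semi-passive, edges in $T\cap E_+$, and $\varepsilon_-(T)$, $\overline{\varepsilon}_-(T)$ the numbers of externally semi-active, respectively semi-passive, edges in $E_-\setminus T$. The polynomial. For an alternating diagram $D$ of $K$ with Tait digraph $G$, a root $r$, and a basepoint $q$ in a face of $G$ adjacent to $r$ (its boundary contains $r$), $$P_K(x,y,z,w)=\sum_{T}x^{-\iota_+(T)}y^{-\overline{\iota}_+(T)}z^{\varepsilon_-(T)}w^{\overline{\varepsilon}_-(T)}\in\mathbb{Z}[x^{-1},y^{-1},z,w],$$ summed over all spanning trees $T$ of $G$. It does not depend on the choice of alternating diagram or of adjacent pair $(r,q)$. *)

(* Defs.v *)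
From Stdlib Require Export Relation_Operators.
From mathcomp Require Export all_boot all_order all_algebra all_fingroup.
From mathcomp Require Export mpoly.

Set Implicit Arguments.
Unset Strict Implicit.
Unset Printing Implicit Defensive.

Import GRing.Theory.

(** * Oriented link diagrams

   A diagram is given by finitely many points on its strands, including both
   preimages of every crossing and at least one point on every component; the
   other points are plain.  [nxt] is the next point along the orientation, so
   the components are its cycles, and each point v stands also for the piece
   of strand from v to [nxt v].  A crossing is a triple (point on the
   overstrand, point on the understrand, is it positive).  Signs and
   orientations determine the cyclic order of the four ends at a crossing, so
   these data describe an oriented combinatorial map; [planar] says that it
   lies on the sphere. *)

Definition crossing (V : finType) : finType := (V * V * bool)%type.

Section Crossing.
Variable V : finType.
Definition over (c : crossing V) : V := c.1.1.
Definition under (c : crossing V) : V := c.1.2.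
Definition positive (c : crossing V) : bool := c.2.
Definition strand_at (b : bool) (c : crossing V) : V :=
  if b then over c else under c.
Definition map_crossing (W : finType) (f : V -> W) (c : crossing V) :
  crossing W := (f (over c), f (under c), positive c).
End Crossing.

Record diagram := Diagram {
  pt : finType;
  nxt : {perm pt};
  crossings : {set crossing pt}
}.

Section Diagram.
Variable D : diagram.

Definition crossing_at (v : pt D) : option (crossing (pt D)) :=
  [pick c in crossings D | (over c == v) || (under c == v)].

Definition plain (v : pt D) : bool := crossing_at v == None.

Definition is_over (v : pt D) : bool := [exists c in crossings D, over c == v].

(* The strand ends at v: (v, true) is outgoing, (v, false) is incoming. *)
Definition dart : finType := (pt D * bool)%type.

(* The other end of the same piece of strand. *)
Definition opp (d : dart) : dart :=
  if d.2 then (nxt D d.1, false) else ((nxt D)^-1%g d.1, true).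

(* The next end clockwise around the same vertex.  The clockwise order is
   over-out, under-in, over-in, under-out at a positive crossing and
   over-out, under-out, over-in, under-in at a negative one. *)
Definition turn (d : dart) : dart :=
  match crossing_at d.1 with
  | None => (d.1, ~~ d.2)
  | Some c => if d.1 == over c then (under c, d.2 (+) positive c)
              else (over c, d.2 (+) ~~ positive c)
  end.

(* Walking along the boundary of the region lying on the left of d, when one
   leaves its vertex along d. *)
Definition next_dart (d : dart) : dart := turn (opp d).

Definition region (d : dart) : {set dart} := [set e | fconnect next_dart d e].

Definition regions : {set {set dart}} := [set region d | d in [set: dart]].

Definition linked : rel (pt D) := fun v w =>
  [|| nxt D v == w, nxt D w == v
    | [exists c in crossings D, ((over c == v) && (under c == w))
                             || ((over c == w) && (under c == v))]].

Definition pieces : nat := n_comp linked predT.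

(* Every point lies on at most one crossing, once. *)
Definition well_formed : bool :=
  uniq (flatten [seq [:: over c; under c] | c <- enum (crossings D)]).

(* Euler's formula: there are #|pt D| - #|crossings D| vertices and #|pt D|
   edges, and each connected piece has Euler characteristic at most 2. *)
Definition planar : bool :=
  well_formed && (#|regions| == #|crossings D| + pieces.*2)%N.

(* A crossing point and the crossing point that follows it on its component
   are at different levels. *)
Definition alternating : Prop :=
  forall (v : pt D) (n : nat),
    let w := iter n.+1 (nxt D) v in
    ~~ plain v -> ~~ plain w ->
    (forall m, (0 < m <= n)%N -> plain (iter m (nxt D) v)) ->
    is_over w = ~~ is_over v.

End Diagram.

(** * Links

   An oriented link type in S^3 is a class of planar diagrams under pass
   moves: a piece of strand that is the overstrand at each of its crossings is
   rerouted, with its two ends fixed, to any other such piece; or the same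
   with understrands.  Such a move is realized by an isotopy (the rerouted
   piece lies above, resp. below, the rest of the link), and the three
   Reidemeister moves are instances of it, so the classes are the oriented
   link types.  Before and after the move the strands carry the same points;
   this costs nothing since plain points may be added or deleted.
   In a disconnected diagram the relative position of the pieces is not
   recorded, as it does not affect the link type. *)

Lemma omap_perm_inj (V : finType) (s : {perm V}) : injective (omap s).
Proof. by move=> [x|] [y|] //= [] /perm_inj ->. Qed.

(* A new plain point [None] between v and [nxt D v]. *)
Definition subdivide (D : diagram) (v : pt D) : diagram :=
  @Diagram (option (pt D))
    (tperm (Some v) None * perm (omap_perm_inj (s := nxt D)))%g
    [set map_crossing Some c | c in crossings D].

Inductive move : diagram -> diagram -> Prop :=
| Relabel (D E : diagram) (f : pt D -> pt E) :
    bijective f -> (forall v, f (nxt D v) = nxt E (f v)) ->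
    crossings E = [set map_crossing f c | c in crossings D] ->
    move D E
| Subdivide (D : diagram) (v : pt D) : move D (subdivide v)
| Pass (V : finType) (s : {perm V}) (C C' : {set crossing V})
    (b : bool) (v : V) (n : nat) :
    let p := traject s v n in
    uniq p ->
    {in C, forall c, strand_at (~~ b) c \notin p} ->
    {in C', forall c, strand_at (~~ b) c \notin p} ->
    [set c in C | strand_at b c \notin p]
      = [set c in C' | strand_at b c \notin p] ->
    move (Diagram s C) (Diagram s C').

Definition planar_move (D E : diagram) : Prop :=
  [/\ planar D, planar E & move D E].

Definition same_link : diagram -> diagram -> Prop :=
  clos_refl_sym_trans diagram planar_move.

(* A link is split iff it has a disconnected diagram.  This also excludes the
   empty link. *)
Definition nonsplit (D : diagram) : Prop :=
  forall E : diagram, planar E -> same_link E D -> pieces E = 1%N.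

(* All links are oriented and non-split; a link is given by a diagram of it
   and is considered up to [same_link]. *)
Record link := Link {
  diagram_of_link :> diagram;
  link_planar : planar diagram_of_link;
  link_nonsplit : nonsplit diagram_of_link
}.

Definition is_diagram_of (D : diagram) (K : link) : Prop :=
  planar D /\ same_link D K.

Definition alternating_link (K : link) : Prop :=
  exists D : diagram, is_diagram_of D K /\ alternating D.

(** * Connected sum *)

Section SumPerm.
Variables (V W : finType) (s : {perm V}) (t : {perm W}).
Definition sum_map (x : V + W) : V + W :=
  match x with inl v => inl (s v) | inr w => inr (t w) end.
Lemma sum_map_inj : injective sum_map.
Proof. by move=> [x|x] [y|y] //= [] /perm_inj ->. Qed.
Definition sum_perm : {perm V + W} := perm sum_map_inj.
End SumPerm.

(* Cut the pieces of strand leaving v and v' and join the loose ends, so that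
   v is now followed by [nxt D' v'] and v' by [nxt D v]. *)
Definition diagram_sum (D : diagram) (v : pt D) (D' : diagram) (v' : pt D') :
  diagram :=
  @Diagram (pt D + pt D')%type
    (tperm (inl v) (inr v') * sum_perm (nxt D) (nxt D'))%g
    ([set map_crossing inl c | c in crossings D]
       :|: [set map_crossing inr c | c in crossings D']).

(* L is the connected sum of K and K' along the component of K through v and
   the component of K' through v', for some choice of these components. *)
Definition is_connected_sum (K K' L : link) : Prop :=
  exists (D D' : diagram) (v : pt D) (v' : pt D'),
    [/\ is_diagram_of D K, is_diagram_of D' K'
      & same_link (diagram_sum v v') L].

(** * Plane digraphs, spanning trees and activities *)

(* A connected digraph on the sphere, given with the faces on the left and on
   the right of each edge, and with signed edges. *)
Record plane_digraph (N A F : finType) := PlaneDigraph {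
  vertices : {set N};
  edges : {set A};
  faces : {set F};
  tail : A -> N;
  head : A -> N;
  lface : A -> F;
  rface : A -> F;
  epos : pred A
}.

Section Activities.
Variables (N A F : finType) (G : plane_digraph N A F).
Implicit Types (T S : {set A}) (e : A).

(* u and v are joined by an undirected path with edges in S. *)
Definition joined S (u v : N) : bool :=
  connect [rel a b | [exists e in S,
             ((tail G e == a) && (head G e == b))
          || ((tail G e == b) && (head G e == a))]] u v.

(* The edges of S that lie on a cycle in S. *)
Definition cycle_edges S : {set A} :=
  [set e in S | joined (S :\ e) (tail G e) (head G e)].

Definition spanning_tree T : bool :=
  [&& T \subset edges G,
      [forall u in vertices G, forall v in vertices G, joined T u v]
    & cycle_edges T == set0].

Definition Cyc T e : {set A} := cycle_edges (e |: T).

(* The faces f and g are in the same component of the complement of the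
   edges in S. *)
Definition same_side S (f g : F) : bool :=
  connect [rel a b | [exists e in edges G :\: S,
             ((lface G e == a) && (rface G e == b))
          || ((lface G e == b) && (rface G e == a))]] f g.

Variables (r : N) (q : F).

Definition int_semi_active T e : bool := joined (T :\ e) r (tail G e).

(* The direction of e agrees with the orientation of the cycle that has q on
   its left. *)
Definition ext_semi_active T e : bool := same_side (Cyc T e) (lface G e) q.

Definition pos_edges : {set A} := [set e in edges G | epos G e].
Definition neg_edges : {set A} := [set e in edges G | ~~ epos G e].

Definition iota_act T := #|[set e in T :&: pos_edges | int_semi_active T e]|.
Definition iota_pas T := #|[set e in T :&: pos_edges | ~~ int_semi_active T e]|.
Definition eps_act T := #|[set e in neg_edges :\: T | ext_semi_active T e]|.
Definition eps_pas T := #|[set e in neg_edges :\: T | ~~ ext_semi_active T e]|.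

(* The boundary of the face q contains r: some edge on the boundary of q ends
   at r, or G is a single vertex. *)
Definition adjacent : bool :=
  (edges G == set0)
  || [exists e in edges G, (q \in [:: lface G e; rface G e])
                        && (r \in [:: tail G e; head G e])].

Local Open Scope ring_scope.

(* The ring Z[x^-1, y^-1, z, w], in this order of the variables. *)
Definition xinv : {mpoly int[4]} := 'X_(@Ordinal 4 0 isT).
Definition yinv : {mpoly int[4]} := 'X_(@Ordinal 4 1 isT).
Definition zvar : {mpoly int[4]} := 'X_(@Ordinal 4 2 isT).
Definition wvar : {mpoly int[4]} := 'X_(@Ordinal 4 3 isT).

Definition tree_polynomial : {mpoly int[4]} :=
  \sum_(T : {set A} | spanning_tree T)
     xinv ^+ iota_act T * yinv ^+ iota_pas T
       * zvar ^+ eps_act T * wvar ^+ eps_pas T.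

End Activities.

(** * The Tait digraph and the invariant *)

(* S is the set of the darts whose left region is shaded.  At a crossing with
   the overstrand drawn from lower left to upper right, the top (bottom)
   region is on the left of the outgoing (incoming) end of the overstrand. *)
Definition checkerboard (D : diagram) (S : {set dart D}) : Prop :=
  [/\ forall d, (next_dart d \in S) = (d \in S),
      forall d, (opp d \in S) = (d \notin S)
    & {in crossings D, forall c b, (over c, b) \in S}].

(* The faces of the Tait digraph of a connected diagram correspond to the
   unshaded regions. The edge through c points from the bottom region to the
   top one; its left region is on the left of the outgoing end of the
   understrand at a positive crossing, of the incoming end at a negative
   one. *)
Definition tait (D : diagram) (S : {set dart D}) :
  plane_digraph {set dart D} (crossing (pt D)) {set dart D} :=
  {| vertices := [set region d | d in S];
     edges := crossings D;
     faces := [set region d | d in ~: S];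
     tail := fun c => region ((over c, false) : dart D);
     head := fun c => region ((over c, true) : dart D);
     lface := fun c => region ((under c, positive c) : dart D);
     rface := fun c => region ((under c, ~~ positive c) : dart D);
     epos := @positive (pt D) |}.

(* P is the polynomial invariant of alternating links: it is computed by any
   alternating diagram and any adjacent pair (r, q). *)
Definition is_polynomial_invariant (P : link -> {mpoly int[4]}) : Prop :=
  forall (K : link) (D : diagram) (S : {set dart D})
         (r : {set dart D}) (q : {set dart D}),
    is_diagram_of D K -> alternating D -> checkerboard S ->
    r \in vertices (tait S) -> q \in faces (tait S) ->
    adjacent (tait S) r q ->
    P K = tree_polynomial (tait S) r q.

(* Main.v *)
Require Import Defs.
From mathcomp Require Import zify.

(* A planar connected diagram has a checkerboard colouring, since the first
   homology of the sphere with F_2 coefficients vanishes; the diagram is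
   alternating iff the ends of the overstrands all lie on the same colour.  A
   summand can be slid along the other diagram: past a crossing, the transverse
   strand is rerouted around it by one pass move.  Hence the link type of a
   connected sum depends on the diagrams of the summands only through their link
   types and the chosen components, and the summands may be taken alternating
   and joined along pieces of strand with the same colours, so that the sum is
   alternating.  Its Tait digraph is then the wedge of the two Tait digraphs at
   the shaded regions next to the joined strands, which also identifies the
   adjacent unshaded regions.  With the root and the basepoint in these regions,
   spanning trees of the wedge are pairs of spanning trees, with the same
   activities, so the polynomial is a product. *)

Set Implicit Arguments.
Unset Strict Implicit.
Unset Printing Implicit Defensive.

Import GRing.Theory.

(** * Connectedness, crossings and regions *)

(** Planarity is only Euler's count for a rotation system, so the vanishing of homology becomes a
    comparison of ranks of incidence matrices over F_2. Colourings are needed even before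
    alternation: planarity of a sum rests on the two sides of a cut strand being different regions,
    and a colouring proves that they are. A chain of pass moves may run through arbitrary planar
    diagrams, whereas planarity of a sum is established for connected summands. Non-splitness
    bridges this gap: it is carried along the chain and makes each diagram in it connected.
    Components are never followed through a move. It is enough that each point of one diagram has
    some point of the other giving an equivalent sum, because sliding makes the points of one
    component interchangeable. *)

Lemma iter_perm_return (T : finType) (s : {perm T}) (x y : T) :
  s x = y -> exists n, iter n s y = x.
Proof.
move=> <-; exists (fingraph.order s x).-1.
by rewrite -iterSr prednK ?order_gt0 // iter_order //; apply: perm_inj.
Qed.

Lemma strand_at_map (V W : finType) (f : V -> W) b (c : crossing V) :
  strand_at b (map_crossing f c) = f (strand_at b c).
Proof. by case: b. Qed.

Lemma map_crossing_inj (V W : finType) (f : V -> W) :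
  injective f -> injective (map_crossing f).
Proof.
by move=> f_inj [[a b] s] [[a' b'] s'] []; rewrite /over /under /= => /f_inj -> /f_inj -> ->.
Qed.

Section Diagram.
Variable D : diagram.
Implicit Types (v w : pt D) (c : crossing (pt D)) (d : dart D).

(** Closure under [nxt] alone suffices: on a cycle, going forward far enough also goes back. Values
    in [Prop] allow existential invariants in the connectedness arguments. *)
Definition strand_stable (Z : pt D -> Prop) :=
  (forall v, Z v -> Z (nxt D v)) /\
  {in crossings D, forall c, Z (over c) <-> Z (under c)}.

Lemma linked_sym : ssrbool.symmetric (@linked D).
Proof.
move=> v w; rewrite /linked orbCA; congr (_ || (_ || _)).
by apply/eq_existsb => c; rewrite [X in _ && X]orbC.
Qed.

Lemma stable_connect Z v w :
  strand_stable Z -> connect (@linked D) v w -> Z v -> Z w.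
Proof.
move=> [Zn Zc] /connectP [p pth ->] {w}.
elim: p v pth => //= u p IHp v /andP[lvu pth] Zv; apply: IHp => //.
case/or3P: lvu => [/eqP <-|/eqP uv|/existsP[c /andP[cC]]]; first exact: Zn.
  have [n <-] := iter_perm_return uv.
  by elim: n => //= n IHn; apply: Zn.
by case/orP=> /andP[/eqP e1 /eqP e2]; have := Zc c cC; rewrite e1 e2; tauto.
Qed.

Lemma pieces1P :
  pieces D = 1%N <->
  (exists v : pt D, True) /\
  (forall Z, strand_stable Z -> forall v w, Z v -> Z w).
Proof.
have csym : connect_sym (@linked D) by apply: sym_connect_sym linked_sym.
split=> [p1|[[v _] conn]].
  have /cards1P[u /setP defu] : #|[set v | roots (@linked D) v]| == 1%N.
    by rewrite -p1; apply/eqP/eq_card => v; rewrite !inE andbT.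
  have rootE v : fingraph.root (@linked D) v = u.
    by apply/set1P; rewrite -defu inE; apply: roots_root.
  split; first by exists u.
  move=> Z stZ v w; apply: stable_connect => //.
  by rewrite -(root_connect csym) !rootE.
rewrite /pieces -(n_comp_connect csym v); apply: eq_n_comp_r => w.
apply/esym; apply: (conn (fun w => connect (@linked D) v w)) (connect0 _ v).
split=> [x vx|c cC].
  by apply: connect_trans vx _; apply: connect1; rewrite /linked eqxx.
split=> vx; apply: connect_trans vx _; apply: connect1;
  by rewrite /linked; apply/or3P/Or33/existsP; exists c; rewrite cC !eqxx ?orbT.
Qed.

(** The form in which [well_formed] is used: a point determines the crossing through it and its
    level there. *)
Definition separated :=
  forall c1 c2 b1 b2, c1 \in crossings D -> c2 \in crossings D ->
  strand_at b1 c1 = strand_at b2 c2 -> c1 = c2 /\ b1 = b2.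

Lemma well_formedP : well_formed D <-> separated.
Proof.
pose B c := [:: over c; under c].
have inB c v : reflect (exists b, v = strand_at b c) (v \in B c).
  rewrite !inE; apply: (iffP orP) => [[/eqP->|/eqP->]|[[] ->]].
  - by exists true.
  - by exists false.
  - by left.
  - by right.
have flatP (s : seq (crossing (pt D))) : uniq s ->
    uniq (flatten [seq B c | c <- s]) <->
    (forall c1 c2 b1 b2, c1 \in s -> c2 \in s ->
     strand_at b1 c1 = strand_at b2 c2 -> c1 = c2 /\ b1 = b2).
  elim: s => [|c s IHs] //= /andP[cs us]; have {}IHs := IHs us.
  have hasP' : (over c \in flatten [seq B c0 | c0 <- s])
     || (under c \in flatten [seq B c0 | c0 <- s]) <->
     exists b c' b', c' \in s /\ strand_at b c = strand_at b' c'.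
    split.
      case/orP => /flatten_mapP[c' c's /inB[b e]].
        by exists true, c', b.
      by exists false, c', b.
    move=> [b [c' [b' [c's e]]]].
    have : strand_at b c \in flatten [seq B c0 | c0 <- s].
      by apply/flatten_mapP; exists c' => //; apply/inB; exists b'.
    by case: b {e} => /= ->; rewrite ?orbT.
  rewrite /= inE negb_or -!andbA; split.
    case/and4P=> ou on un uf c1 c2 b1 b2.
    have nex : ~ exists b c' b', c' \in s /\ strand_at b c = strand_at b' c'.
      by move/hasP'; rewrite (negbTE on) (negbTE un).
    rewrite !inE => /predU1P[->|c1s] /predU1P[->|c2s] e; try (split; by []).
    - split=> //; case: b1 b2 e => [] [] //= e; first by rewrite e eqxx in ou.
      by rewrite e eqxx in ou.
    - by case: nex; exists b1, c2, b2.
    - by case: nex; exists b2, c1, b1.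
    - by move/IHs: uf => /(_ c1 c2 b1 b2); apply.
  move=> H; apply/and4P; split.
  - by apply/eqP => e; case: (H c c true false); rewrite ?mem_head.
  - apply: contraTN isT => on; suff: c \in s by rewrite (negbTE cs).
    have /hasP'[b [c' [b' [c's e]]]] : (over c \in flatten [seq B c0 | c0 <- s])
     || (under c \in flatten [seq B c0 | c0 <- s]) by rewrite on.
    by case: (H c c' b b'); rewrite ?mem_head ?inE ?c's ?orbT // => ->.
  - apply: contraTN isT => un; suff: c \in s by rewrite (negbTE cs).
    have /hasP'[b [c' [b' [c's e]]]] : (over c \in flatten [seq B c0 | c0 <- s])
     || (under c \in flatten [seq B c0 | c0 <- s]) by rewrite un orbT.
    by case: (H c c' b b'); rewrite ?mem_head ?inE ?c's ?orbT // => ->.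
  - apply/IHs => c1 c2 b1 b2 c1s c2s; apply: H; by rewrite inE ?c1s ?c2s orbT.
rewrite /well_formed; have := flatP _ (enum_uniq (crossings D)).
case=> f g; split=> [/f h c1 c2 b1 b2 m1 m2|h].
  by apply: h; rewrite mem_enum.
by apply: g => c1 c2 b1 b2; rewrite !mem_enum; apply: h.
Qed.

Lemma plainP v :
  plain v <-> {in crossings D, forall c b, strand_at b c <> v}.
Proof.
rewrite /plain /crossing_at; case: pickP => [c /andP[cC h]|h].
  split=> // /(_ c cC) H; case/orP: h => /eqP e; first by case: (H true).
  by case: (H false).
split=> // _ c cC b e; have := h c; rewrite cC -e.
by case: b {e}; rewrite /= eqxx ?orbT.
Qed.

Hypothesis sep : separated.

Variant point_spec v : Prop :=
| PointOver c of c \in crossings D & v = over c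
| PointUnder c of c \in crossings D & v = under c
| PointPlain of plain v.

Lemma pointP v : point_spec v.
Proof.
have [p|] := boolP (plain v); first exact: PointPlain.
rewrite /plain /crossing_at; case: pickP => // c /andP[cC /orP[/eqP e|/eqP e]] _.
  exact: PointOver cC (esym e).
exact: PointUnder cC (esym e).
Qed.

Lemma crossing_at_strand b c :
  c \in crossings D -> crossing_at (strand_at b c) = Some c.
Proof.
move=> cC; rewrite /crossing_at; case: pickP => [c' /andP[c'C h]|].
  congr Some; case/orP: h => /eqP h.
    by case: (sep (b1 := true) (b2 := b) c'C cC).
  by case: (sep (b1 := false) (b2 := b) c'C cC).
by move=> /(_ c); rewrite cC /=; case: b; rewrite eqxx ?orbT.
Qed.

Lemma not_plain b c : c \in crossings D -> plain (strand_at b c) = false.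
Proof. by move=> cC; rewrite /plain crossing_at_strand. Qed.

Lemma turn_over c b : c \in crossings D ->
  turn (over c, b) = (under c, b (+) positive c).
Proof.
by move=> cC; rewrite /turn (crossing_at_strand true cC) /= eqxx.
Qed.

Lemma turn_under c b : c \in crossings D ->
  turn (under c, b) = (over c, b (+) ~~ positive c).
Proof.
move=> cC; rewrite /turn (crossing_at_strand false cC) /=.
case: eqP => // e.
by case: (sep (b1 := true) (b2 := false) cC cC).
Qed.

Lemma turn_plain v b : plain v -> turn (v, b) = (v, ~~ b).
Proof. by move/eqP=> pv; rewrite /turn pv. Qed.

Lemma is_over_strand b c : c \in crossings D -> is_over (strand_at b c) = b.
Proof.
move=> cC; apply/existsP/idP => [[c' /andP[c'C /eqP e]]|bT].
  by case: (sep (b1 := true) (b2 := b) c'C cC) => // _ <-.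
by exists c; rewrite cC bT /=.
Qed.

(** At a crossing four turns visit the two strands alternately and come back, whatever the sign; at
    a plain point two already do. Hence the third iterate inverts [turn]. *)
Lemma turn4 d : turn (turn (turn (turn d))) = d.
Proof.
case: d => v b; case: (pointP v) => [c cC ->|c cC ->|pv].
- by rewrite turn_over // turn_under // turn_over // turn_under //;
     case: b; case: positive.
- by rewrite turn_under // turn_over // turn_under // turn_over //;
     case: b; case: positive.
- by rewrite !turn_plain // !negbK.
Qed.

Lemma turn_inj : injective (@turn D).
Proof. exact: (can_inj (g := fun d => turn (turn (turn d)))) turn4. Qed.

Lemma oppK : involutive (@opp D).
Proof. by case=> v []; rewrite /opp /= ?permK ?permKV. Qed.

Lemma next_dart_inj : injective (@next_dart D).
Proof. by move=> d e /turn_inj /(can_inj oppK). Qed.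

Lemma next_dart_opp d : next_dart (opp d) = turn d.
Proof. by rewrite /next_dart oppK. Qed.

Lemma region_eq d e : (region d == region e) = fconnect (@next_dart D) d e.
Proof.
apply/eqP/idP => [/setP/(_ e)|de].
  by rewrite !inE connect0.
apply/setP => x; rewrite !inE; apply: same_connect de x.
exact: fconnect_sym next_dart_inj.
Qed.

Lemma region_next d : region (next_dart d) = region d.
Proof. by apply/esym/eqP; rewrite region_eq fconnect1. Qed.

Lemma region_turn d : region (turn d) = region (opp d).
Proof. by rewrite -next_dart_opp region_next. Qed.

End Diagram.

(** * Incidence matrices over F_2 *)

Section Incidence.
Local Open Scope ring_scope.

Section Matrix.
Variables (E X : finType) (s t : E -> X).

(** Over F_2 the orientation of an edge does not matter, and a loop gets a zero column because its
    two ends cancel. *)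
Definition incidence : 'M['F_2]_(#|X|, #|E|) :=
  \matrix_(i, j) ((s (enum_val j) == enum_val i)%:R
                + (t (enum_val j) == enum_val i)%:R).

Lemma mul_incidence (u : 'rV['F_2]_#|X|) j :
  (u *m incidence) 0 j = u 0 (enum_rank (s (enum_val j)))
                       + u 0 (enum_rank (t (enum_val j))).
Proof.
rewrite mxE; under eq_bigr do rewrite mxE mulrDr.
rewrite big_split /=; congr (_ + _).
  rewrite (bigD1 (enum_rank (s (enum_val j)))) //= enum_rankK eqxx mulr1.
  rewrite big1 ?addr0 // => i ne; case: eqP => [e|_]; last by rewrite mulr0.
  by rewrite e enum_valK eqxx in ne.
rewrite (bigD1 (enum_rank (t (enum_val j)))) //= enum_rankK eqxx mulr1.
rewrite big1 ?addr0 // => i ne; case: eqP => [e|_]; last by rewrite mulr0.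
by rewrite e enum_valK eqxx in ne.
Qed.

Lemma addF2_eq0 (a b : 'F_2) : (a + b == 0) = (a == b).
Proof.
by case: a b => [[|[|?]] //= ?] [[|[|?]] //= ?].
Qed.

Hypothesis conn : forall f : X -> 'F_2,
  (forall e, f (s e) = f (t e)) -> forall x y, f x = f y.

(** A vector of the left kernel takes equal values at the two ends of each edge, so by connectedness
    it is constant: the kernel has dimension at most 1. *)
Lemma rank_incidence : (#|X| <= (\rank incidence).+1)%N.
Proof.
have := mxrank_ker incidence.
suff : (\rank (kermx incidence) <= 1)%N by move=> ? ?; lia.
suff /mxrankS : (kermx incidence <= (const_mx 1 : 'rV['F_2]_#|X|))%MS.
  by move/leq_trans; apply; apply: rank_leq_row.
apply/row_subP => i; set u := row i _.
have uM : u *m incidence = 0.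
  by apply/sub_kermxP; apply: row_sub.
case: (posnP #|X|) => [X0|Xpos].
  suff -> : u = 0 by apply: sub0mx.
  by apply/rowP => k; move: (leq_ltn_trans (leq0n k) (ltn_ord k)); rewrite {1}X0.
pose k0 := Ordinal Xpos.
have uc x y : u 0 (enum_rank x) = u 0 (enum_rank y).
  apply: (conn (f := fun x => u 0 (enum_rank x))) => e.
  have := mul_incidence u (enum_rank e); rewrite uM mxE enum_rankK => /esym/eqP.
  by rewrite addF2_eq0 => /eqP.
suff -> : u = u 0 k0 *: const_mx 1 by apply: scalemx_sub.
apply/rowP => k; rewrite [RHS]mxE [const_mx _ _ _]mxE mulr1.
by have := uc (enum_val k) (enum_val k0); rewrite !enum_valK.
Qed.

End Matrix.

Section Duality.
Variables (E X Y : finType) (s t : E -> X) (l r : E -> Y).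
Hypothesis connX : forall f : X -> 'F_2,
  (forall e, f (s e) = f (t e)) -> forall x y, f x = f y.
Hypothesis connY : forall f : Y -> 'F_2,
  (forall e, f (l e) = f (r e)) -> forall x y, f x = f y.
Hypothesis euler : (#|E| + 2 <= #|X| + #|Y|)%N.
Hypothesis orth : forall x y, \sum_e
  ((s e == x)%:R + (t e == x)%:R) * ((l e == y)%:R + (r e == y)%:R) = 0 :> 'F_2.
Hypothesis even : forall x, \sum_e ((s e == x)%:R + (t e == x)%:R) = 0 :> 'F_2.

(* The row spaces of the two incidence matrices are orthogonal, and Euler's
   formula makes their ranks add up to #|E|, so each is the orthogonal of the
   other; the all-ones vector is orthogonal to the first, by [even]. *)
Lemma dual_coloring : exists f : Y -> bool, forall e, f (r e) = ~~ f (l e).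
Proof.
pose M := incidence s t; pose N := incidence l r.
have MN : N *m M^T = 0.
  apply/matrixP => i j; rewrite !mxE -[RHS](orth (enum_val j) (enum_val i)).
  rewrite [RHS](reindex _ (onW_bij _ (@enum_val_bij E))) /=.
  by apply: eq_bigr => k _; rewrite !mxE mulrC.
have NK : (N <= kermx M^T)%MS by apply/sub_kermxP.
have rkK : (\rank (kermx M^T) <= \rank N)%N.
  rewrite mxrank_ker mxrank_tr; have := rank_incidence connX.
  by have := rank_incidence connY; rewrite -/M -/N; lia.
have KN : (kermx M^T <= N)%MS.
  by move: (mxrank_leqif_sup NK) => [_ <-]; rewrite eqn_leq rkK (mxrankS NK).
have : ((const_mx 1 : 'rV['F_2]_#|E|) <= N)%MS.
  apply: submx_trans KN; apply/sub_kermxP/rowP => j; rewrite !mxE.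
  rewrite -[RHS](even (enum_val j)) [RHS](reindex _ (onW_bij _ (@enum_val_bij E))) /=.
  by apply: eq_bigr => k _; rewrite !mxE mul1r.
(* The coordinates of [u] are the colours: the entry 1 at every edge says that its two sides
   differ. *)
case/submxP => u eu; exists (fun y => u 0 (enum_rank y) != 0) => e.
have := mul_incidence l r u (enum_rank e); rewrite -/N -eu mxE enum_rankK.
case: (u 0 _) => [[|[|?]] //= i]; case: (u 0 _) => [[|[|?]] //= i'].
Qed.
End Duality.
End Incidence.

(** * Colourings of planar diagrams *)

Section Coloring.
Variable D : diagram.
Implicit Types (v w : pt D) (c : crossing (pt D)) (d : dart D) (S : {set dart D}).

Definition coloring S :=
  (forall d, (next_dart d \in S) = (d \in S)) /\
  (forall d, (opp d \in S) = (d \notin S)).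

Lemma coloringC S : coloring S -> coloring (~: S).
Proof. by case=> h1 h2; split=> d; rewrite !inE ?h1 ?h2. Qed.

Lemma coloring_turn S d : coloring S -> (turn d \in S) = (d \notin S).
Proof. by case=> h1 h2; rewrite -next_dart_opp h1 h2. Qed.

Hypothesis sep : separated D.

(** Turning joins the two levels of a crossing and the two ends at a point, so links between points
    lift to darts. Applied to regions, this is the connectedness of the dual graph. *)
Lemma dart_connected (T : Type) (g : dart D -> T) : pieces D = 1%N ->
  (forall d, g (next_dart d) = g d) -> (forall d, g (opp d) = g d) ->
  forall d e, g d = g e.
Proof.
move=> /pieces1P[_ conn] gn go.
have gt d : g (turn d) = g d by rewrite -next_dart_opp gn go.
have gb v b : g (v, b) = g (v, true).
  case: b => //; case: (pointP v) => [c cC ->|c cC ->|pv].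
  - by rewrite -gt turn_over // -gt turn_under //; case: positive.
  - by rewrite -gt turn_under // -gt turn_over //; case: positive.
  - by rewrite -[LHS]gt turn_plain.
suff gc v w : g (v, true) = g (w, true).
  by move=> [v b] [w b']; rewrite gb [RHS]gb.
apply: (conn (fun w => g (v, true) = g (w, true))) (erefl _); split=> [u ->|c cC].
  by rewrite -go /= gb.
by rewrite -(gt (over c, true)) turn_over // gb.
Qed.

Definition unders : {set pt D} := [set under c | c in crossings D].

Lemma card_unders : #|unders| = #|crossings D|.
Proof.
apply: card_in_imset => c1 c2 C1 C2 e.
by case: (sep (b1 := false) (b2 := false) C1 C2 e).
Qed.

(* Both preimages of a crossing are represented by the upper one. *)
Definition vertex_point v :=
  if [pick c in crossings D | under c == v] is Some c then over c else v.

Lemma vertex_point_under c : c \in crossings D -> vertex_point (under c) = over c.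
Proof.
move=> cC; rewrite /vertex_point; case: pickP => [c' /andP[c'C /eqP e]|/(_ c)].
  by case: (sep (b1 := false) (b2 := false) c'C cC e) => ->.
by rewrite cC eqxx.
Qed.

Lemma vertex_point_id v : v \notin unders -> vertex_point v = v.
Proof.
rewrite /vertex_point; case: pickP => // c /andP[cC /eqP <-].
by rewrite imset_f.
Qed.

Lemma over_unders c : c \in crossings D -> over c \notin unders.
Proof.
move=> cC; apply/imsetP => -[c' c'C e].
by case: (sep (b1 := true) (b2 := false) cC c'C e).
Qed.

Lemma vertex_pointP v : vertex_point v \notin unders.
Proof.
have [/imsetP[c cC ->]|vU] := boolP (v \in unders).
  by rewrite vertex_point_under // over_unders.
by rewrite vertex_point_id.
Qed.

Let vertex : finType := {v | v \notin unders}.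
Let face : finType := {R | R \in regions D}.
Let vert d : vertex := exist (fun v => v \notin unders) _ (vertex_pointP d.1).
Let regP d : region d \in regions D. Proof. by apply: imset_f; rewrite inE. Qed.
Let reg d : face := exist (fun R => R \in regions D) _ (regP d).

Let vert_turn d : vert (turn d) = vert d.
Proof.
apply: val_inj; case: d => v b /=; case: (pointP v) => [c cC ->|c cC ->|pv].
- by rewrite turn_over // vertex_point_under // vertex_point_id // over_unders.
- by rewrite turn_under // vertex_point_under // vertex_point_id // over_unders.
- by rewrite turn_plain.
Qed.

Let reg_next d : reg (next_dart d) = reg d.
Proof. by apply: val_inj; rewrite /= region_next. Qed.

Local Open Scope ring_scope.

(** Passes from edges to their ends, on which [turn] acts as a reindexing around each vertex. *)
Lemma sum_darts (R : nmodType) (F : dart D -> R) :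
  \sum_d F d = \sum_(v : pt D) (F (v, true) + F (opp (v, true))).
Proof.
rewrite (eq_bigr (fun d => F (d.1, d.2))) => [|[] //].
rewrite -(pair_bigA _ (fun v b => F (v, b))) /= big_split /=.
rewrite [X in _ + X](_ : _ = \sum_v F (v, false)).
  by rewrite -big_split; apply: eq_bigr => v _; rewrite big_bool.
by rewrite [RHS](reindex_inj (@perm_inj _ (nxt D))).
Qed.

Let addF2 (a : 'F_2) : a + a = 0.
Proof. by case: a => [[|[|?]] //= ?]; apply: val_inj. Qed.

Lemma planar_coloring : planar D -> pieces D = 1%N -> exists S, coloring S.
Proof.
move=> /andP[_ /eqP eulerD] p1; have /pieces1P[[v0 _] conn] := p1.
(* The edges are the pieces of strand, the vertices of the first graph are the crossings and the
   plain points, and the second graph is the dual one, on the regions. *)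
have [] := @dual_coloring (pt D) vertex face (fun v => vert (v, true))
  (fun v => vert (opp (v, true))) (fun v => reg (v, true))
  (fun v => reg (opp (v, true))).
- move=> f fe x y.
  have repE (z : vertex) : z = vert (val z, true).
    by apply: val_inj; rewrite /= vertex_point_id // (valP z).
  rewrite (repE x) (repE y).
  apply: (conn (fun w => f (vert (val x, true)) = f (vert (w, true)))) (erefl _).
  split=> [u ->|c cC]; first exact: fe.
  have -> // : vert (over c, true) = vert (under c, true).
  apply: val_inj; rewrite /= vertex_point_under // vertex_point_id //.
  exact: over_unders.
- move=> f fe [x xR] [y yR].
  have /imsetP[d _ ex] := xR; have /imsetP[e _ ey] := yR.
  have -> : exist _ x xR = reg d by apply: val_inj.
  have -> : exist _ y yR = reg e by apply: val_inj.
  apply: (@dart_connected _ (fun d => f (reg d))) => // [z|[v []]].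
  + by rewrite reg_next.
  + by rewrite fe.
  + by rewrite /opp /= fe /opp /= permKV.
- rewrite !card_sig (_ : #|[pred R | R \in regions D]| = #|regions D|); last exact: eq_card.
  rewrite (_ : #|[pred v | v \notin unders]| = #|~: unders|); last first.
    by apply: eq_card => v; rewrite !inE.
  have := cardsC unders; rewrite card_unders eulerD p1; lia.
- move=> x y.
  pose F d : 'F_2 := (vert d == x)%:R * ((reg d == y)%:R + (reg (opp d) == y)%:R).
  transitivity (\sum_d F d).
    rewrite sum_darts; apply: eq_bigr => v _.
    by rewrite /F oppK mulrDl [X in _ + _ * X = _]addrC.
  rewrite /F; under eq_bigr do rewrite mulrDr.
  rewrite big_split /= [X in _ + X](_ : _ = \sum_d (vert d == x)%:R * (reg d == y)%:R) //.
  (* The right side of an end is the left side of the next end clockwise, so the two sums are equal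
     and cancel over F_2. *)
  rewrite [RHS](reindex_inj (turn_inj sep)); apply: eq_bigr => d _.
  by rewrite vert_turn -[turn d]next_dart_opp reg_next.
(* Every vertex is entered as often as it is left, since [nxt] permutes the points. *)
- move=> x; rewrite big_split /= [X in _ + X](_ : _ = \sum_v (vert (v, true) == x)%:R) //.
  by rewrite [RHS](reindex_inj (@perm_inj _ (nxt D))).
move=> f fr; exists [set d | f (reg d)]; split=> [d|[v b]]; rewrite !inE ?reg_next //.
case: b; first by rewrite fr.
by have := fr ((nxt D)^-1%g v); rewrite /opp /= permKV => ->; rewrite negbK.
Qed.

End Coloring.

(** * Regions of a connected sum *)

Lemma fconnect_ind (T : finType) (f : T -> T) (Q : T -> Prop) x y :
  Q x -> (forall z, Q z -> Q (f z)) -> fconnect f x y -> Q y.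
Proof. by move=> Qx Qf /iter_findex <-; elim: (findex _ _ _) => //= k; apply: Qf. Qed.

(* [m] is the disjoint sum of [n] and [n'], except that the images of x and x'
   are exchanged, and likewise those of y and y'.  If x' and y' lie on different
   cycles of [n'], the cycles of [m] are those of [n] and [n'], with the one of x
   merged with that of x' and the one of y with that of y'. *)
Section Splice.
Variables (T T' U : finType) (n : T -> T) (n' : T' -> T') (m : U -> U).
Variables (i : T -> U) (j : T' -> U) (x y : T) (x' y' : T').
Hypotheses (n_inj : injective n) (n'_inj : injective n') (m_inj : injective m).
Hypotheses (i_inj : injective i) (j_inj : injective j) (ij : forall d d', i d <> j d').
Hypothesis mi : forall d, d != x -> d != y -> m (i d) = i (n d).
Hypothesis mix : m (i x) = j (n' x').
Hypothesis miy : m (i y) = j (n' y').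
Hypothesis mj : forall d, d != x' -> d != y' -> m (j d) = j (n' d).
Hypothesis mjx : m (j x') = i (n x).
Hypothesis mjy : m (j y') = i (n y).
Hypothesis xy' : ~~ fconnect n' x' y'.

(** Invariant of the walk of [m] from [i d]: it enters the second part at one of the two marks and,
    by [xy'], can leave it only at the same mark. *)
Let splice_class (d : T) (u : U) :=
  (exists2 e, u = i e & fconnect n d e) \/
  (exists2 e', u = j e' &
     (fconnect n d x && fconnect n' x' e') || (fconnect n d y && fconnect n' y' e')).

Let splice_classP d u : fconnect m (i d) u -> splice_class d u.
Proof.
have csym' := fconnect_sym n'_inj.
apply: fconnect_ind; first by left; exists d.
move=> z [[e -> de]|[e' -> /orP[] /andP[dx xe]]].
- have [ex|nx] := eqVneq e x.
    by right; exists (n' x'); rewrite ?ex ?mix // -ex de fconnect1.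
  have [ey|ny] := eqVneq e y.
    by right; exists (n' y'); rewrite ?ey ?miy // -ey de fconnect1 orbT.
  by left; exists (n e); rewrite ?mi // -(same_fconnect1_r n_inj).
- have [ex|nx] := eqVneq e' x'.
    by left; exists (n x); rewrite ?ex ?mjx // -(same_fconnect1_r n_inj).
  have [ey|ny] := eqVneq e' y'; first by move: xy'; rewrite -ey xe.
  by right; exists (n' e'); rewrite ?mj // dx -(same_fconnect1_r n'_inj) xe.
- have [ey|ny] := eqVneq e' y'.
    by left; exists (n y); rewrite ?ey ?mjy // -(same_fconnect1_r n_inj).
  have [ex|nx] := eqVneq e' x'; first by move: xy'; rewrite csym' -ex xe.
  by right; exists (n' e'); rewrite ?mj // dx -(same_fconnect1_r n'_inj y') xe orbT.
Qed.

(** A detour: the walk leaves [i x] for the cycle of [x'], does not meet [y'] there, and goes round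
    until it reaches [x'], from where it continues to [i (n x)]. *)
Let reach_x k : fconnect m (i x) (j (iter k.+1 n' x')).
Proof.
elim: k => [|k IHk]; first by rewrite /= -mix fconnect1.
have [ex|nx] := eqVneq (iter k.+1 n' x') x'.
  by rewrite iterS ex -mix fconnect1.
have ny : iter k.+1 n' x' != y'.
  by apply: contraNneq xy' => <-; apply: fconnect_iter.
by rewrite iterS -mj // -(same_fconnect1_r m_inj).
Qed.

Let reach_y k : fconnect m (i y) (j (iter k.+1 n' y')).
Proof.
elim: k => [|k IHk]; first by rewrite /= -miy fconnect1.
have [ey|ny] := eqVneq (iter k.+1 n' y') y'.
  by rewrite iterS ey -miy fconnect1.
have nx : iter k.+1 n' y' != x'.
  apply: contraNneq xy' => <-; rewrite (fconnect_sym n'_inj); exact: fconnect_iter.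
by rewrite iterS -mj // -(same_fconnect1_r m_inj).
Qed.

Let reach_xx : fconnect m (i x) (j x').
Proof.
have := reach_x (fingraph.order n' x').-1.
by rewrite prednK ?order_gt0 // iter_order.
Qed.

Let reach_yy : fconnect m (i y) (j y').
Proof.
have := reach_y (fingraph.order n' y').-1.
by rewrite prednK ?order_gt0 // iter_order.
Qed.

Let splice_next d : fconnect m (i d) (i (n d)).
Proof.
have [->|nx] := eqVneq d x; first by rewrite -mjx -(same_fconnect1_r m_inj).
have [->|ny] := eqVneq d y; first by rewrite -mjy -(same_fconnect1_r m_inj).
by rewrite -mi // fconnect1.
Qed.

Lemma fconnect_splice d e : fconnect m (i d) (i e) = fconnect n d e.
Proof.
apply/idP/idP => [/splice_classP[[e0 /i_inj -> //]|[e' /ij //]]|].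
move=> de; apply: (fconnect_ind (Q := fun e => fconnect m (i d) (i e)) _ _ de).
  exact: connect0.
by move=> z dz; apply: connect_trans dz (splice_next z).
Qed.

Lemma fconnect_splice_cross d d' : fconnect m (i d) (j d') =
  (fconnect n d x && fconnect n' x' d') || (fconnect n d y && fconnect n' y' d').
Proof.
apply/idP/idP => [/splice_classP[[e /esym /ij //]|[e' /j_inj -> //]]|].
case/orP=> /andP[dz /iter_findex <-].
  apply: (@connect_trans _ _ (i x)); first by rewrite fconnect_splice.
  by case: (findex _ _ _) => [|k]; [apply: reach_xx | apply: reach_x].
apply: (@connect_trans _ _ (i y)); first by rewrite fconnect_splice.
by case: (findex _ _ _) => [|k]; [apply: reach_yy | apply: reach_y].
Qed.

End Splice.

Lemma card_imset_eq (T X Y : finType) (f : T -> X) (g : T -> Y) (A : {set T}) :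
  {in A &, forall a b, (f a == f b) = (g a == g b)} -> #|f @: A| = #|g @: A|.
Proof.
move=> fg; suff H (X1 Y1 : finType) (f1 : T -> X1) (g1 : T -> Y1) :
    {in A &, forall a b, (f1 a == f1 b) = (g1 a == g1 b)} -> (#|f1 @: A| <= #|g1 @: A|)%N.
  by apply/eqP; rewrite eqn_leq !H // => a b aA bA; rewrite fg.
move=> {f g fg} fg.
have [->|[a0 a0A]] := set_0Vmem A; first by rewrite !imset0 !cards0.
pose h z := f1 (odflt a0 [pick a in A | g1 a == z]).
apply: leq_trans (leq_imset_card h _); apply/subset_leq_card/subsetP => z.
case/imsetP=> a aA ->; apply/imsetP; exists (g1 a); first exact: imset_f.
rewrite /h; case: pickP => [b /andP[bA]|/(_ a)] /=; last by rewrite aA eqxx.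
by rewrite -fg // => /eqP.
Qed.

Section Sum.
Variables (D D' : diagram) (v : pt D) (v' : pt D').
Local Notation DS := (diagram_sum v v').
Definition dartl (d : dart D) : dart DS := (inl d.1, d.2).
Definition dartr (d : dart D') : dart DS := (inr d.1, d.2).

Lemma nxt_sum z : nxt DS z = sum_map (nxt D) (nxt D') (tperm (inl v) (inr v') z).
Proof. by rewrite /= permM permE. Qed.

Lemma nxt_suml w : nxt DS (inl w) = if w == v then inr (nxt D' v') else inl (nxt D w).
Proof.
rewrite nxt_sum; case: eqVneq => [->|nv]; first by rewrite tpermL.
by rewrite tpermD // eq_sym.
Qed.

Lemma nxt_sumr w : nxt DS (inr w) = if w == v' then inl (nxt D v) else inr (nxt D' w).
Proof.
rewrite nxt_sum; case: eqVneq => [->|nv]; first by rewrite tpermR.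
by rewrite tpermD // eq_sym.
Qed.

Lemma nxtV_suml w : (nxt DS)^-1%g (inl w) =
  if w == nxt D v then inr v' else inl ((nxt D)^-1%g w).
Proof.
apply: (@perm_inj _ (nxt DS)); rewrite permKV; case: ifP => [/eqP->|nw].
  by rewrite nxt_sumr eqxx.
rewrite nxt_suml permKV; case: eqP => // e; by rewrite -e permKV eqxx in nw.
Qed.
Lemma nxtV_sumr w : (nxt DS)^-1%g (inr w) =
  if w == nxt D' v' then inl v else inr ((nxt D')^-1%g w).
Proof.
apply: (@perm_inj _ (nxt DS)); rewrite permKV; case: ifP => [/eqP->|nw].
  by rewrite nxt_suml eqxx.
rewrite nxt_sumr permKV; case: eqP => // e; by rewrite -e permKV eqxx in nw.
Qed.

Lemma crossings_sumP c : reflect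
  ((exists2 c0, c0 \in crossings D & c = map_crossing inl c0) \/
   (exists2 c0, c0 \in crossings D' & c = map_crossing inr c0))
  (c \in crossings DS).
Proof.
rewrite inE; apply: (iffP orP) => [[/imsetP|/imsetP]|[[c0 h ->]|[c0 h ->]]].
- by left.
- by right.
- by left; apply: imset_f.
- by right; apply: imset_f.
Qed.

Lemma crossings_suml c : c \in crossings D -> map_crossing inl c \in crossings DS.
Proof. by move=> h; rewrite inE imset_f. Qed.

Lemma crossings_sumr c : c \in crossings D' -> map_crossing inr c \in crossings DS.
Proof. by move=> h; rewrite inE imset_f ?orbT. Qed.

Lemma card_crossings_sum : #|crossings DS| = (#|crossings D| + #|crossings D'|)%N.
Proof.
have [il ir] : injective (map_crossing (@inl (pt D) (pt D'))) /\
    injective (map_crossing (@inr (pt D) (pt D'))).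
  by split; apply: map_crossing_inj => ? ? [].
rewrite /= cardsU !card_imset // (_ : _ :&: _ = set0) ?cards0 ?subn0 //.
by apply/setP => c; rewrite !inE; apply/andP => -[/imsetP[c1 _ ->] /imsetP[c2 _ []]].
Qed.

Hypotheses (sep : separated D) (sep' : separated D').

Lemma separated_sum : separated DS.
Proof.
move=> c1 c2 b1 b2 /crossings_sumP[] [d1 C1 ->] /crossings_sumP[] [d2 C2 ->];
  rewrite !strand_at_map //.
  by case=> /sep[] // -> ->.
by case=> /sep'[] // -> ->.
Qed.
Let sepS := separated_sum.

Lemma plain_suml w : plain (inl w : pt DS) = plain w.
Proof.
apply/idP/idP => /plainP h; apply/plainP => c.
  move=> cC b e; apply: (h _ (crossings_suml cC) b).
  by rewrite strand_at_map e.
by case/crossings_sumP => [] [c0 c0C ->] b; rewrite strand_at_map // => -[]; apply: h.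
Qed.

Lemma plain_sumr w : plain (inr w : pt DS) = plain w.
Proof.
apply/idP/idP => /plainP h; apply/plainP => c.
  move=> cC b e; apply: (h _ (crossings_sumr cC) b).
  by rewrite strand_at_map e.
by case/crossings_sumP => [] [c0 c0C ->] b; rewrite strand_at_map // => -[]; apply: h.
Qed.

Lemma turn_suml d : turn (dartl d) = dartl (turn d).
Proof.
case: d => w b; rewrite /dartl /=; case: (pointP w) => [c cC ->|c cC ->|pw].
- rewrite turn_over //; exact: (turn_over sepS (c := map_crossing inl c) b (crossings_suml cC)).
- rewrite turn_under //; exact: (turn_under sepS (c := map_crossing inl c) b (crossings_suml cC)).
- by rewrite !turn_plain // plain_suml.
Qed.

Lemma turn_sumr d : turn (dartr d) = dartr (turn d).
Proof.
case: d => w b; rewrite /dartr /=; case: (pointP w) => [c cC ->|c cC ->|pw].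
- rewrite turn_over //; exact: (turn_over sepS (c := map_crossing inr c) b (crossings_sumr cC)).
- rewrite turn_under //; exact: (turn_under sepS (c := map_crossing inr c) b (crossings_sumr cC)).
- by rewrite !turn_plain // plain_sumr.
Qed.

Definition cutl : dart D := (v, true).
Definition cutr : dart D' := (v', true).

Lemma next_suml d : d != cutl -> d != opp cutl -> next_dart (dartl d) = dartl (next_dart d).
Proof.
rewrite /next_dart -turn_suml => h h'; congr turn; move: h h'.
case: d => w []; rewrite /cutl /opp /dartl !xpair_eqE ?andbT ?andbF /= => h h'.
  by rewrite nxt_suml (negbTE h).
by rewrite nxtV_suml (negbTE h').
Qed.

Lemma next_sumr d : d != cutr -> d != opp cutr -> next_dart (dartr d) = dartr (next_dart d).
Proof.
rewrite /next_dart -turn_sumr => h h'; congr turn; move: h h'.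
case: d => w []; rewrite /cutr /opp /dartr !xpair_eqE ?andbT ?andbF /= => h h'.
  by rewrite nxt_sumr (negbTE h).
by rewrite nxtV_sumr (negbTE h').
Qed.

Lemma next_cutl : next_dart (dartl cutl) = dartr (next_dart cutr).
Proof. by rewrite /next_dart -turn_sumr; congr turn; rewrite /opp /dartl /= nxt_suml eqxx. Qed.

Lemma next_cutr : next_dart (dartr cutr) = dartl (next_dart cutl).
Proof. by rewrite /next_dart -turn_suml; congr turn; rewrite /opp /dartr /= nxt_sumr eqxx. Qed.

Lemma next_opp_cutl : next_dart (dartl (opp cutl)) = dartr (next_dart (opp cutr)).
Proof.
by rewrite /next_dart -turn_sumr; congr turn; rewrite /opp /dartl /= nxtV_suml eqxx /= permK.
Qed.

Lemma next_opp_cutr : next_dart (dartr (opp cutr)) = dartl (next_dart (opp cutl)).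
Proof.
by rewrite /next_dart -turn_suml; congr turn; rewrite /opp /dartr /= nxtV_sumr eqxx /= permK.
Qed.

Hypothesis cutl_sides : region (opp cutl) != region cutl.
Hypothesis cutr_sides : region (opp cutr) != region cutr.

Let dartl_inj : injective dartl.
Proof. by move=> [a b] [a' b'] [-> ->]. Qed.
Let dartr_inj : injective dartr.
Proof. by move=> [a b] [a' b'] [-> ->]. Qed.
Let sidel : ~~ fconnect (@next_dart D) cutl (opp cutl).
Proof. by rewrite -region_eq // eq_sym. Qed.
Let sider : ~~ fconnect (@next_dart D') cutr (opp cutr).
Proof. by rewrite -region_eq // eq_sym. Qed.

(** The boundary walks of the sum are the spliced ones, with the ends of the two cut strands as
    marks. *)
Lemma region_suml d e : (region (dartl d) == region (dartl e)) = (region d == region e).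
Proof.
rewrite !region_eq //; apply: (fconnect_splice (j := dartr) (n' := @next_dart D')
  (x := cutl) (y := opp cutl) (x' := cutr) (y' := opp cutr)) => //.
- exact: next_dart_inj.
- exact: next_dart_inj.
- exact: next_dart_inj.
- exact: next_suml.
- exact: next_cutl.
- exact: next_opp_cutl.
- exact: next_sumr.
- exact: next_cutr.
- exact: next_opp_cutr.
Qed.

Lemma region_sumr d e : (region (dartr d) == region (dartr e)) = (region d == region e).
Proof.
rewrite !region_eq //; apply: (fconnect_splice (j := dartl) (n' := @next_dart D)
  (x := cutr) (y := opp cutr) (x' := cutl) (y' := opp cutl)) => //.
- exact: next_dart_inj.
- exact: next_dart_inj.
- exact: next_dart_inj.
- exact: next_sumr.
- exact: next_cutr.
- exact: next_opp_cutr.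
- exact: next_suml.
- exact: next_cutl.
- exact: next_opp_cutl.
Qed.

Lemma region_sum_cross d e : (region (dartl d) == region (dartr e)) =
  (region d == region cutl) && (region e == region cutr) ||
  (region d == region (opp cutl)) && (region e == region (opp cutr)).
Proof.
rewrite [region e == _]eq_sym [region e == region (opp _)]eq_sym !region_eq //.
apply: (fconnect_splice_cross (x := cutl) (y := opp cutl)) => //.
- exact: next_dart_inj.
- exact: next_dart_inj.
- exact: next_dart_inj.
- exact: next_suml.
- exact: next_cutl.
- exact: next_opp_cutl.
- exact: next_sumr.
- exact: next_cutr.
- exact: next_opp_cutr.
Qed.

(** One region of each summand is merged on either side of the cut, and the two merged regions
    differ because the sides of the cut strand do. *)
Lemma card_regions_sum : (#|regions DS| + 2 = #|regions D| + #|regions D'|)%N.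
Proof.
pose Rl := (fun d => region (dartl d)) @: [set: dart D].
pose Rr := (fun d => region (dartr d)) @: [set: dart D'].
have -> : regions DS = Rl :|: Rr.
  apply/setP => R; apply/imsetP/setUP.
    case=> [[[w|w] b] _ ->]; [left|right]; apply/imsetP;
      by exists (w, b); rewrite ?inE.
  by case=> /imsetP[d _ ->]; [exists (dartl d) | exists (dartr d)]; rewrite ?inE.
have -> : #|regions D| = #|Rl|.
  by apply: card_imset_eq => d e _ _; rewrite region_suml.
have -> : #|regions D'| = #|Rr|.
  by apply: card_imset_eq => d e _ _; rewrite region_sumr.
rewrite -cardsUI; congr (_ + _)%N.
have -> : Rl :&: Rr = [set region (dartl cutl); region (dartl (opp cutl))].
  apply/setP => R; rewrite !inE; apply/andP/orP.
    case=> /imsetP[d _ ->] /imsetP[e _ /eqP]; rewrite region_sum_cross.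
    by case/orP=> /andP[/eqP h _]; [left|right]; rewrite region_suml h.
  case=> /eqP ->; split; apply/imsetP.
  - by exists cutl.
  - exists cutr => //; apply/eqP; by rewrite region_sum_cross !eqxx.
  - by exists (opp cutl).
  - exists (opp cutr) => //; apply/eqP; by rewrite region_sum_cross !eqxx orbT.
by rewrite cards2 region_suml eq_sym cutl_sides.
Qed.

End Sum.

(** * Connectedness and planarity of a sum *)

Section SumPieces.
Variables (D D' : diagram) (v : pt D) (v' : pt D').
Local Notation DS := (diagram_sum v v').

(** At [v] the strand makes a full excursion along the cycle of [v'] before it arrives at
    [inl (nxt D v)]. *)
Lemma stable_suml Z : strand_stable Z -> strand_stable (fun w => Z (inl w : pt DS)).
Proof.
case=> Zn Zc; split=> [w Zw|c cC]; last exact: Zc (crossings_suml v v' cC).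
have [ew|nw] := eqVneq w v; last first.
  by have := Zn _ Zw; rewrite nxt_suml (negbTE nw).
have Z0 : Z (inr (nxt D' v')) by have := Zn _ Zw; rewrite nxt_suml ew eqxx.
have Zk k : Z (inr (iter k.+1 (nxt D') v')).
  elim: k => [|k IHk]; first exact: Z0.
  have := Zn _ IHk; rewrite nxt_sumr; case: eqP => [e _|//].
  by rewrite iterS e.
have [n en] := iter_perm_return (erefl (nxt D' v')).
have := Zk n; rewrite iterSr en => /Zn.
by rewrite nxt_sumr eqxx ew.
Qed.

Lemma stable_sumr Z : strand_stable Z -> strand_stable (fun w => Z (inr w : pt DS)).
Proof.
case=> Zn Zc; split=> [w Zw|c cC]; last exact: Zc (crossings_sumr v v' cC).
have [ew|nw] := eqVneq w v'; last first.
  by have := Zn _ Zw; rewrite nxt_sumr (negbTE nw).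
have Z0 : Z (inl (nxt D v)) by have := Zn _ Zw; rewrite nxt_sumr ew eqxx.
have Zk k : Z (inl (iter k.+1 (nxt D) v)).
  elim: k => [|k IHk]; first exact: Z0.
  have := Zn _ IHk; rewrite nxt_suml; case: eqP => [e _|//].
  by rewrite iterS e.
have [n en] := iter_perm_return (erefl (nxt D v)).
have := Zk n; rewrite iterSr en => /Zn.
by rewrite nxt_suml eqxx ew.
Qed.

Lemma pieces_sum : pieces D = 1%N -> pieces D' = 1%N -> pieces DS = 1%N.
Proof.
move=> /pieces1P[_ conn] /pieces1P[_ conn']; apply/pieces1P.
split=> [|Z stZ]; first by exists (inl v).
have cl a b := conn _ (stable_suml stZ) a b.
have cr a b := conn' _ (stable_sumr stZ) a b.
have [Zn _] := stZ.
case=> a [] b Za.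
- exact: cl Za.
- apply: (cr (nxt D' v')); have := Zn _ (cl _ v Za); by rewrite nxt_suml eqxx.
- apply: (cl (nxt D v)); have := Zn _ (cr _ v' Za); by rewrite nxt_sumr eqxx.
- exact: cr Za.
Qed.

End SumPieces.

Definition planar_connected D := planar D /\ pieces D = 1%N.

Lemma planar_separated D : planar D -> separated D.
Proof. by case/andP => /well_formedP. Qed.

Lemma coloring_region D (S : {set dart D}) (d e : dart D) : coloring S -> region d = region e ->
  (d \in S) = (e \in S).
Proof.
case=> h _ de; have : e \in region d by rewrite de inE connect0.
rewrite inE; apply: (fconnect_ind (Q := fun e => (d \in S) = (e \in S))) => //.
by move=> z ->; rewrite h.
Qed.

Lemma coloring_sides D (S : {set dart D}) (d : dart D) : coloring S -> region (opp d) != region d.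
Proof.
move=> colS; apply/eqP => /(coloring_region colS).
by case: colS => _ ->; case: (d \in S).
Qed.

(** A region lying on both sides of a piece of strand would have two colours. *)
Lemma planar_sides D (d : dart D) : planar_connected D -> region (opp d) != region d.
Proof.
case=> pl p1; have [S colS] := planar_coloring (planar_separated pl) pl p1.
exact: coloring_sides colS.
Qed.

(** For connected diagrams Euler's formula reads regions = crossings + 2. Crossings add up and the
    sum loses two regions, so the formula persists. *)
Lemma planar_sum D D' (v : pt D) (v' : pt D') :
  planar_connected D -> planar_connected D' -> planar_connected (diagram_sum v v').
Proof.
move=> pcD pcD'; have [pD cD] := pcD; have [pD' cD'] := pcD'.
have sep := planar_separated pD; have sep' := planar_separated pD'.
have cS := pieces_sum v v' cD cD'; split=> //.
apply/andP; split; first exact/well_formedP/separated_sum.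
have := card_regions_sum sep sep' (planar_sides (cutl v) pcD) (planar_sides (cutr v') pcD').
case/andP: pD => _ /eqP ->; case/andP: pD' => _ /eqP ->.
rewrite card_crossings_sum cD cD' cS => e; apply/eqP; move: e; lia.
Qed.

(** * Planarity of relabelled and subdivided diagrams *)

Definition relabeling (D E : diagram) (f : pt D -> pt E) :=
  [/\ bijective f, forall v, f (nxt D v) = nxt E (f v)
    & crossings E = [set map_crossing f c | c in crossings D]].

Section Relabel.
Variables (D E : diagram) (f : pt D -> pt E).
Hypothesis fR : relabeling f.
Let f_bij : bijective f. Proof. by case: fR. Qed.
Let fn v : f (nxt D v) = nxt E (f v). Proof. by case: fR. Qed.
Let f_inj := bij_inj f_bij.
Let fC c : c \in crossings D -> map_crossing f c \in crossings E.
Proof. by case: fR => _ _ -> cC; apply: imset_f. Qed.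
Let EC c : c \in crossings E -> exists2 c0, c0 \in crossings D & c = map_crossing f c0.
Proof. by case: fR => _ _ -> /imsetP. Qed.

Lemma separated_relabel : separated D -> separated E.
Proof.
move=> sep c1 c2 b1 b2 /EC[d1 C1 ->] /EC[d2 C2 ->]; rewrite !strand_at_map.
by move/f_inj/sep => [] // -> ->.
Qed.

Hypothesis sep : separated D.
Let sepE := separated_relabel sep.
Let fd (d : dart D) : dart E := (f d.1, d.2).
Let fd_inj : injective fd.
Proof. by move=> [a b] [a' b'] [/f_inj -> ->]. Qed.

Let plain_relabel v : plain (f v) = plain v.
Proof.
apply/idP/idP => /plainP h; apply/plainP => c.
  by move=> cC b e; apply: (h _ (fC cC) b); rewrite strand_at_map e.
by case/EC => c0 c0C -> b; rewrite strand_at_map => /f_inj; apply: h.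
Qed.

Let next_relabel d : next_dart (fd d) = fd (next_dart d).
Proof.
have turn_relabel e : turn (fd e) = fd (turn e).
  case: e => w b; rewrite /fd /=; case: (pointP w) => [c cC ->|c cC ->|pw].
  - rewrite turn_over //; exact: (turn_over sepE (c := map_crossing f c) b (fC cC)).
  - rewrite turn_under //; exact: (turn_under sepE (c := map_crossing f c) b (fC cC)).
  - by rewrite !turn_plain // plain_relabel.
rewrite /next_dart -turn_relabel; congr turn.
case: d => w []; rewrite /opp /fd /= ?fn //; congr pair.
by apply: (@perm_inj _ (nxt E)); rewrite permKV -fn permKV.
Qed.

Lemma planar_relabel : planar_connected D -> planar_connected E.
Proof.
case=> pl p1; have pE1 : pieces E = 1%N.
  have /pieces1P[[v0 _] conn] := p1; apply/pieces1P; split; first by exists (f v0).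
  case: f_bij => g fK gK Z [Zn Zc] x y Zx; rewrite -(gK y).
  apply: (conn (fun w => Z (f w)) _ (g x)); last by rewrite gK.
  by split=> [w /Zn|c /fC/Zc]; rewrite ?fn.
split=> //; apply/andP; split; first exact/well_formedP.
have -> : #|crossings E| = #|crossings D|.
  by case: fR => _ _ ->; rewrite card_imset //; apply: map_crossing_inj.
case/andP: pl => _; rewrite p1 pE1 => /eqP <-.
have -> : regions E = (fun d => region (fd d)) @: [set: dart D].
  apply/setP => R; apply/imsetP/imsetP => [[[w b] _ ->]|[d _ ->]].
    by case: f_bij => g fK gK; exists (g w, b); rewrite // /fd /= gK.
  by exists (fd d).
apply/eqP; apply: card_imset_eq => d e _ _; rewrite !region_eq //.
have it k : iter k (@next_dart E) (fd d) = fd (iter k (@next_dart D) d).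
  by elim: k => //= k ->; rewrite next_relabel.
apply/idP/idP => /iter_findex; first by rewrite it => /fd_inj <-; apply: fconnect_iter.
by move <-; rewrite -it; apply: fconnect_iter.
Qed.
End Relabel.

(** The crossingless unknot with one point. Subdividing a strand amounts to taking the sum with it,
    so planarity of subdivisions follows from [planar_sum]. *)
Definition circle : diagram := @Diagram unit 1%g set0.

Lemma planar_circle : planar_connected circle.
Proof.
have sep : separated circle by move=> c1 c2 b1 b2; rewrite inE.
have p1 : pieces circle = 1%N.
  by apply/pieces1P; split; [exists tt | move=> Z _ [] []].
split=> //; apply/andP; split; first exact/well_formedP.
rewrite p1 cards0 /regions (@card_imset_eq _ _ _ _ id) ?imset_id.
  by rewrite cardsT card_prod card_unit card_bool.
have next_id (d : dart circle) : next_dart d = d.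
  have pl (w : pt circle) : plain w by apply/plainP => c; rewrite inE.
  by case: d => [[] []]; rewrite /next_dart /opp /= turn_plain //;
    congr pair; case: (fun_of_perm _ _).
move=> d e _ _; rewrite region_eq //; apply/idP/eqP => [/iter_findex <-|->].
  by elim: (findex _ _ _) => //= k <-; rewrite next_id.
exact: connect0.
Qed.

Lemma nxt_subdivide D (v : pt D) z :
  nxt (subdivide v) z = omap (nxt D) (tperm (Some v) None z).
Proof. by rewrite /= permM permE. Qed.

Lemma planar_subdivide D (v : pt D) :
  planar_connected D -> planar_connected (subdivide v).
Proof.
move=> pD.
pose f (z : pt (diagram_sum v (tt : pt circle))) : pt (subdivide v) :=
  if z is inl w then Some w else None.
apply: (@planar_relabel (diagram_sum v (tt : pt circle)) _ f).
- split.
  + by exists (fun z => if z is Some w then inl w else inr tt); [move=> [?|[]] | move=> [?|]].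
  + move=> [w|[]]; rewrite nxt_subdivide.
      rewrite nxt_suml /f; case: eqVneq => [->|nw]; first by rewrite tpermL.
      by rewrite tpermD // eq_sym.
    by rewrite nxt_sumr eqxx /f tpermR.
  + by rewrite /= imset0 setU0 -imset_comp.
- exact: separated_sum (planar_separated pD.1) (planar_separated planar_circle.1).
- exact: planar_sum planar_circle.
Qed.

(** * Elementary equivalences of diagrams *)

Lemma same_link_refl D : same_link D D.
Proof. exact: rst_refl. Qed.

Lemma same_link_sym D E : same_link D E -> same_link E D.
Proof. exact: rst_sym. Qed.

Lemma same_link_trans D E F : same_link D E -> same_link E F -> same_link D F.
Proof. exact: rst_trans. Qed.

Lemma same_link_relabel D E (f : pt D -> pt E) :
  planar_connected D -> relabeling f -> same_link D E.
Proof.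
move=> pD fR; have [pE _] := planar_relabel fR (planar_separated pD.1) pD.
apply: rst_step; split; [exact: pD.1 | exact: pE |].
by case: fR; apply: Relabel.
Qed.

Lemma same_link_subdivide D (v : pt D) :
  planar_connected D -> same_link D (subdivide v).
Proof.
move=> pD; apply: rst_step; split; [exact: pD.1 | | exact: Subdivide].
exact: (planar_subdivide v pD).1.
Qed.

Lemma same_link_sum_sym D D' (v : pt D) (v' : pt D') :
  planar_connected D -> planar_connected D' ->
  same_link (diagram_sum v v') (diagram_sum v' v).
Proof.
move=> pD pD'.
pose f (z : pt (diagram_sum v v')) : pt (diagram_sum v' v) :=
  match z with inl w => inr w | inr w => inl w end.
apply: (@same_link_relabel _ _ f); first exact: planar_sum.
split.
- by exists (fun z => match z with inl w => inr w | inr w => inl w end) => -[].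
- by move=> [w|w]; rewrite ?nxt_suml ?nxt_sumr /=; case: ifP.
- by rewrite /= imsetU -!imset_comp setUC.
Qed.

(** * Sliding a summand along a strand *)

Lemma map_crossing_id (V : finType) (f : V -> V) (c : crossing V) :
  (forall b, f (strand_at b c) = strand_at b c) -> map_crossing f c = c.
Proof.
case: c => [[a b] s] h; rewrite /map_crossing.
by rewrite (h true) (h false).
Qed.

Section Reroute.
Variables (V : finType) (t : {perm V}) (s : {perm option V}).
Variables (C : {set crossing V}) (A : V).
Hypothesis sep : separated (Diagram t C).
Let tau := tperm (Some A) None.
Let C1 := [set map_crossing tau c | c in [set map_crossing Some c | c in C]].
Let C2 := [set map_crossing Some c | c in C].

(* The strand that crosses at A is rerouted, as a one-point pass move, so that
   it crosses at the new point [None] instead. *)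
Lemma same_link_reroute :
  planar (Diagram s C1) -> planar (Diagram s C2) ->
  same_link (Diagram s C1) (Diagram s C2).
Proof.
have tauS w : tau (Some w) = if w == A then None else Some w.
  case: eqVneq => [->|ne]; first by rewrite /tau tpermL.
  by rewrite /tau tpermD // eq_sym.
have tau_id c : (forall b, strand_at b c != A) ->
    map_crossing tau (map_crossing Some c) = map_crossing Some c.
  move=> h; apply: map_crossing_id => b.
  by rewrite strand_at_map tauS (negbTE (h b)).
move=> pl1 pl2.
have [/plainP pA|nA] := boolP (plain (A : pt (Diagram t C))).
  suff -> : C1 = C2 by apply: same_link_refl.
  rewrite /C1 -imset_comp; apply: eq_in_imset => c cC.
  by apply: tau_id => b; apply/eqP/pA.
have [b0 [c0 c0C eA]] : exists b0, exists2 c0, c0 \in C & A = strand_at b0 c0.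
  case: (pointP (A : pt (Diagram t C))) => [c cC e|c cC e|pA].
  - by exists true, c.
  - by exists false, c.
  - by rewrite pA in nA.
have fix_c0 c : c \in C -> c != c0 -> forall b, strand_at b c != A.
  move=> cC ne b; apply: contraNneq ne; rewrite eA => e.
  by case: (sep (c1 := c) (c2 := c0) cC c0C e) => ->.
have nAB : strand_at (~~ b0) c0 != A.
  by apply/eqP; rewrite eA => /(sep c0C c0C)[_]; case: (b0).
apply: rst_step; split=> //.
(* The moved piece is the other preimage of [c0], at level [~~ b0]: it crosses the strand at [None]
   in [C1] and at [Some A] in [C2], and no other crossing changes. *)
apply: (@Pass _ s C1 C2 (~~ b0) (Some (strand_at (~~ b0) c0)) 1) => //=.
- move=> c /imsetP[c' /imsetP[c1 c1C ->] ->]; rewrite negbK !strand_at_map inE tauS.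
  case: ifP => // _; apply/eqP => -[/(sep c1C c0C)[_]]; by case: (b0).
- move=> c /imsetP[c1 c1C ->]; rewrite negbK strand_at_map inE.
  apply/eqP => -[/(sep c1C c0C)[_]]; by case: (b0).
apply/setP => c; rewrite !inE; apply/andP/andP => -[].
- case/imsetP=> c' /imsetP[c1 c1C ->] ->; rewrite !strand_at_map tauS => h.
  have ne : c1 != c0 by apply: contraNneq h => ->; rewrite (negbTE nAB).
  rewrite (negbTE (fix_c0 _ c1C ne (~~ b0))) in h *.
  rewrite (tau_id _ (fix_c0 _ c1C ne)); split=> //.
  exact: imset_f.
- case/imsetP=> c1 c1C ->; rewrite strand_at_map => h.
  have ne : c1 != c0 by apply: contraNneq h => ->.
  split=> //.
  rewrite -(tau_id _ (fix_c0 _ c1C ne)); apply: imset_f; exact: imset_f.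
Qed.
End Reroute.

Section Slide.
Variables (D D' : diagram) (u : pt D) (v' : pt D').
Hypotheses (pD : planar_connected D) (pD' : planar_connected D').

(* Subdividing both sums puts a new point next to the summand D': before it in X,
   after it in Y.  Up to exchanging the names of [a] and [None], the strands of X
   and Y coincide, and only the crossing at [a], if any, has moved past D'. *)
Lemma same_link_slide :
  same_link (diagram_sum u v') (diagram_sum (nxt D u) v').
Proof.
have [->|ua] := eqVneq (nxt D u) u; first exact: same_link_refl.
set a := nxt D u in ua *.
pose X := subdivide (inl u : pt (diagram_sum u v')).
pose Y := subdivide (inr v' : pt (diagram_sum a v')).
pose tau : {perm pt X} := tperm (Some (inl a)) None.
pose X' := Diagram (nxt Y) [set map_crossing tau c | c in crossings X].
have pu := planar_sum u v' pD pD'; have pa := planar_sum a v' pD pD'.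
have pX : planar_connected X by apply: planar_subdivide.
have pY : planar_connected Y by apply: planar_subdivide.
have tauA : tau (Some (inl a)) = None by rewrite /tau tpermL.
have tauN : tau None = Some (inl a) by rewrite /tau tpermR.
have tauL w : w != a -> tau (Some (inl w)) = Some (inl w).
  by move=> nw; rewrite /tau tpermD // eq_sym.
have tauR w : tau (Some (inr w)) = Some (inr w) by rewrite /tau tpermD.
have nX z : nxt X z = match z with None => Some (inr (nxt D' v'))
   | Some (inl w) => if w == u then None else Some (inl (nxt D w))
   | Some (inr w) => if w == v' then Some (inl a) else Some (inr (nxt D' w)) end.
  rewrite nxt_subdivide; case: z => [[w|w]|]; last by rewrite tpermR [LHS]/= nxt_suml eqxx.
    case: (eqVneq w u) => [->|nw]; first by rewrite tpermL.
    rewrite tpermD 1?eq_sym //; first by rewrite [LHS]/= nxt_suml (negbTE nw).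
  by rewrite tpermD // [LHS]/= nxt_sumr; case: ifP.
have nY z : nxt Y z = match z with None => Some (inl (nxt D a))
   | Some (inl w) => if w == a then Some (inr (nxt D' v')) else Some (inl (nxt D w))
   | Some (inr w) => if w == v' then None else Some (inr (nxt D' w)) end.
  rewrite nxt_subdivide; case: z => [[w|w]|]; last by rewrite tpermR [LHS]/= nxt_sumr eqxx.
    by rewrite tpermD // [LHS]/= nxt_suml; case: ifP.
  case: (eqVneq w v') => [->|nw]; first by rewrite tpermL.
  by rewrite tpermD 1?eq_sym // [LHS]/= nxt_sumr (negbTE nw).
have tau_rel : @relabeling X X' tau.
  split=> //; first by exists tau; apply: tpermK.
  have nau : nxt D a != a by rewrite (inj_eq perm_inj).
  move=> z; change (nxt X') with (nxt Y); rewrite nX.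
  case: z => [[w|w]|]; last by rewrite tauN tauR nY eqxx.
    case: (eqVneq w u) => [->|nw]; first by rewrite tauN tauL 1?eq_sym // nY eq_sym (negbTE ua).
    have na : nxt D w != a by rewrite (inj_eq perm_inj).
    rewrite (tauL _ na); case: (eqVneq w a) => [->|nwa]; first by rewrite tauA nY.
    by rewrite (tauL _ nwa) nY (negbTE nwa).
  case: (eqVneq w v') => [->|nw]; first by rewrite tauA tauR nY eqxx.
  by rewrite !tauR nY (negbTE nw).
have pX' : planar_connected X' := planar_relabel tau_rel (planar_separated pX.1) pX.
apply: (same_link_trans (same_link_subdivide (inl u : pt (diagram_sum u v')) pu)).
apply: (same_link_trans (same_link_relabel pX tau_rel)).
apply: (@same_link_trans _ Y); last first.
  exact: same_link_sym (same_link_subdivide (inr v' : pt (diagram_sum a v')) pa).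
(* The crossings of a sum do not depend on the place of the cut, so [X'] and [Y] are, up to
   conversion, the two diagrams of the rerouting lemma with [A := inl a]. *)
apply: (same_link_reroute (planar_separated pu.1)).
- exact: pX'.1.
- exact: pY.1.
Qed.
End Slide.

(** * Independence of the connected sum of the diagrams *)

Section Transfer.
Variables (D' : diagram) (v' : pt D').
Hypothesis pD' : planar_connected D'.

Lemma same_link_slide_iter D (u : pt D) k : planar_connected D ->
  same_link (diagram_sum u v') (diagram_sum (iter k (nxt D) u) v').
Proof.
move=> pD; elim: k => [|k IHk]; first exact: same_link_refl.
by apply: (same_link_trans IHk); rewrite iterS; apply: same_link_slide.
Qed.

Lemma sum_relabel D E (f : pt D -> pt E) v :
  planar_connected D -> relabeling f ->
  same_link (diagram_sum v v') (diagram_sum (f v) v').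
Proof.
move=> pD [f_bij fn fC]; have f_inj := bij_inj f_bij.
pose F (z : pt (diagram_sum v v')) : pt (diagram_sum (f v) v') :=
  match z with inl w => inl (f w) | inr w => inr w end.
apply: (@same_link_relabel _ _ F); first exact: planar_sum.
split.
- case: f_bij => g fK gK.
  by exists (fun z => match z with inl w => inl (g w) | inr w => inr w end);
    move=> [w|w] //=; rewrite ?fK ?gK.
- move=> [w|w].
    rewrite nxt_suml [F (inl w)]/= nxt_suml (inj_eq f_inj).
    by case: ifP => _; rewrite /F ?fn.
  by rewrite nxt_sumr [F (inr w)]/= nxt_sumr; case: ifP => _; rewrite /F ?fn.
- by rewrite /= fC imsetU -!imset_comp.
Qed.

Lemma sum_subdivide D (u x : pt D) : planar_connected D ->
  same_link (diagram_sum x v') (diagram_sum (Some x : pt (subdivide u)) v').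
Proof.
move=> pD; have pS := planar_sum x v' pD pD'.
(* In the sum, the piece of strand that ends at [nxt D u] starts at [y]: at [inr v'] if the cut is
   at [u], at [inl u] otherwise. *)
pose y : pt (diagram_sum x v') := tperm (inl x) (inr v') (inl u).
apply: (same_link_trans (same_link_subdivide y pS)).
pose f (z : pt (subdivide y)) : pt (diagram_sum (Some x : pt (subdivide u)) v') :=
  match z with None => inl None | Some (inl w) => inl (Some w) | Some (inr w) => inr w end.
apply: (@same_link_relabel _ _ f); first exact: planar_subdivide.
split.
- by exists (fun z => match z with inl None => None | inl (Some w) => Some (inl w)
    | inr w => Some (inr w) end); [move=> [[w|w]|] | move=> [[w|]|w]].
- have yE : y = if x == u then inr v' else inl u.
    rewrite /y; case: eqVneq => [->|n]; first by rewrite tpermL.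
    by rewrite tpermD.
  have nN : f (nxt (subdivide y) None) = inl (Some (nxt D u)).
    rewrite nxt_subdivide tpermR [omap _ _]/= -/(nxt (diagram_sum x v')) nxt_sum.
    by rewrite /y tpermK.
  have nS z : nxt (subdivide y) (Some z) =
      if z == y then None else Some (nxt (diagram_sum x v') z).
    rewrite nxt_subdivide; case: eqVneq => [->|n]; first by rewrite tpermL.
    by rewrite tpermD 1?eq_sym.
  have nsub w : nxt (subdivide u) (Some w) = if w == u then None else Some (nxt D w).
    rewrite nxt_subdivide; case: eqVneq => [->|n]; first by rewrite tpermL.
    by rewrite tpermD 1?eq_sym.
  move=> [[w|w]|].
  + rewrite nS [f (Some _)]/= (nxt_suml (Some x : pt (subdivide u)) v' (Some w)).
    rewrite nsub nxt_suml (inj_eq Some_inj) yE.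
    have [ex|nx] := eqVneq x u.
      by rewrite -ex; case: (w == x).
    rewrite (inj_eq inl_inj); have [->|nw] := eqVneq w u; last by case: (w == x).
    by rewrite eq_sym (negbTE nx).
  + rewrite nS [f (Some _)]/= (nxt_sumr (Some x : pt (subdivide u)) v' w).
    rewrite nsub nxt_sumr yE.
    have [ex|nx] := eqVneq x u; last by case: (w == v').
    by rewrite (inj_eq inr_inj); case: (w == v').
  + by rewrite nN [f None]/= nxt_suml nxt_subdivide tpermR.
- by rewrite /= !imsetU -!imset_comp.
Qed.

(** The cut at [y] changes only the step that leaves [y]. The last point of the piece may therefore
    be [y], but no earlier one. *)
Lemma traject_sum V (s : {perm V}) (C : {set crossing V}) (x y : V) n :
  (forall k, (k.+1 < n)%N -> iter k s x != y) ->
  traject (nxt (diagram_sum (y : pt (Diagram s C)) v')) (inl x) n = map inl (traject s x n).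
Proof.
elim: n x => [|n IHn] x h //; rewrite !trajectS map_cons; congr cons.
case: n IHn h => [//|n] IHn h.
rewrite nxt_suml (negbTE (h 0%N isT)) IHn // => k lk.
by rewrite -iterSr; apply: h.
Qed.

Lemma sum_pass (V : finType) (s : {perm V}) (C C' : {set crossing V})
    (b : bool) (v : V) (n : nat) (y : V) :
  let p := traject s v n in
  uniq p ->
  {in C, forall c, strand_at (~~ b) c \notin p} ->
  {in C', forall c, strand_at (~~ b) c \notin p} ->
  [set c in C | strand_at b c \notin p] = [set c in C' | strand_at b c \notin p] ->
  planar_connected (Diagram s C) -> planar_connected (Diagram s C') ->
  (forall k, (k.+1 < n)%N -> iter k s v != y) ->
  same_link (diagram_sum (y : pt (Diagram s C)) v') (diagram_sum (y : pt (Diagram s C')) v').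
Proof.
move=> p up hC hC' eCC' pC pC' hy.
have ptr := traject_sum C hy.
have inl_mem z : (inl z \in map (@inl V (pt D')) p) = (z \in p).
  by rewrite mem_map // => ? ? [].
have inr_mem z : (inr z \in map (@inl V (pt D')) p) = false.
  by apply/mapP => -[].
have hS (C0 : {set crossing V}) : {in C0, forall c, strand_at (~~ b) c \notin p} ->
   {in crossings (diagram_sum (y : pt (Diagram s C0)) v'), forall c,
     strand_at (~~ b) c \notin map inl p}.
  move=> h c /crossings_sumP[] [c0 c0C ->]; rewrite strand_at_map ?inl_mem ?inr_mem //.
  exact: h.
have eS (C0 : {set crossing V}) :
   [set c in crossings (diagram_sum (y : pt (Diagram s C0)) v') | strand_at b c \notin map inl p]
   = [set map_crossing inl c | c in [set c in C0 | strand_at b c \notin p]]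
     :|: [set map_crossing inr c | c in crossings D'].
  apply/setP => c; rewrite inE; apply/andP/setUP.
    case=> /crossings_sumP[] [c0 c0C ->]; rewrite strand_at_map => h; [left|right].
      by apply: imset_f; rewrite inE c0C -inl_mem.
    exact: imset_f.
  case=> /imsetP[c0 c0C ->]; rewrite strand_at_map ?inl_mem ?inr_mem.
    move: c0C; rewrite inE => /andP[h1 h2]; split=> //.
    exact: (crossings_suml (D := Diagram s C0)).
  by split=> //; apply: (crossings_sumr (D := Diagram s C0)).
apply: rst_step; split.
- exact: (planar_sum _ _ pC pD').1.
- exact: (planar_sum _ _ pC' pD').1.
apply: (@Pass _ _ _ _ b (inl v) n); rewrite ptr.
- by rewrite map_inj_uniq // => ? ? [].
- exact: hS hC.
- exact: hS hC'.
- by rewrite !eS eCC'.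
Qed.

(** Mere existence of a partner is asked for, so that components need not be tracked; having both
    directions makes the relation symmetric, as the induction on [same_link] requires. *)
Definition sum_transfers D E :=
  (forall v : pt D, exists w : pt E, same_link (diagram_sum v v') (diagram_sum w v')) /\
  (forall w : pt E, exists v : pt D, same_link (diagram_sum v v') (diagram_sum w v')).

(* A pass move may reroute the piece of strand where D' is inserted, so D' is
   first slid to the end of that piece. *)
Lemma sum_move D E : move D E -> planar_connected D -> planar_connected E ->
  sum_transfers D E.
Proof.
case=> {D E} [D E f f_bij fn fC|D u|V s C C' b v n p up hC hC' eCC'] pD pE.
- have fR : relabeling f by [].
  split=> w; first by exists (f w); apply: sum_relabel.
  have [g fK gK] := f_bij; exists (g w); rewrite -{2}(gK w).
  exact: sum_relabel.
- split=> w; first by exists (Some w); apply: sum_subdivide.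
  case: w => [w|]; first by exists w; apply: sum_subdivide.
  exists u; apply: (same_link_trans (sum_subdivide u u pD)).
  (* The new point has no counterpart in [D]; it is reached by one slide from [Some u]. *)
  have -> : None = nxt (subdivide u) (Some u) by rewrite nxt_subdivide tpermL.
  exact: same_link_slide.
- have hk x : exists k, forall l, (l.+1 < n)%N -> iter l s v != iter k s x.
    have [/trajectP[k kn ->]|xp] := boolP (x \in p); last first.
      exists 0%N => l ln; apply: contraNneq xp => /= <-; apply/trajectP.
      by exists l => //; apply: ltnW.
    (* From the [k]-th point of the piece this slides to its last point [iter n.-1 s v], which
       differs from all earlier ones because the piece has no repetition. *)
    exists (n.-1 - k)%N => l ln; rewrite -iterD subnK; last by lia.
    have l1 : (l < n)%N by lia.
    have l2 : (n.-1 < n)%N by lia.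
    rewrite -(nth_traject s l1) -(nth_traject s l2) nth_uniq ?size_traject //; lia.
  split=> x; have [k hk'] := hk x; exists (iter k s x).
    apply: (same_link_trans (same_link_slide_iter x k pD)).
    exact: (sum_pass up hC hC' eCC' pD pE hk').
  apply/same_link_sym/(same_link_trans (same_link_slide_iter x k pE))/same_link_sym.
  exact: (sum_pass up hC hC' eCC' pD pE hk').
Qed.

(** The induction must carry [nonsplit] as well: it provides the connectedness that [sum_move] needs
    at every intermediate diagram. *)
Lemma sum_same_link D E : nonsplit D -> same_link D E -> sum_transfers D E.
Proof.
move=> nsD DE; suff: nonsplit D -> nonsplit E /\ sum_transfers D E by case.
elim: {nsD} DE => {D E} [D E [plD plE mv] ns|D ns|D E DE IH ns|D E F DE IH EF IH' ns].
- have DE : same_link D E by apply: rst_step.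
  have nsE : nonsplit E.
    by move=> F plF FE; apply: ns plF _; apply: same_link_trans FE (same_link_sym DE).
  split=> //; apply: sum_move => //; split=> //.
    by apply: ns => //; apply: same_link_refl.
  by apply: nsE => //; apply: same_link_refl.
- by split=> //; split=> v; exists v; apply: same_link_refl.
- have nsD : nonsplit D.
    by move=> F plF FE; apply: ns plF _; apply: same_link_trans FE DE.
  split=> //; have [_ [h1 h2]] := IH nsD.
  split=> v; [have [w] := h2 v|have [w] := h1 v]; exists w; exact: same_link_sym.
- have [nsE [h1 h2]] := IH ns; have [nsF [h3 h4]] := IH' nsE.
  split=> //; split=> v.
    have [w e] := h1 v; have [z e'] := h3 w; exists z; exact: same_link_trans e e'.
  have [w e] := h4 v; have [z e'] := h2 w; exists z; exact: same_link_trans e' e.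
Qed.
End Transfer.

(** * Alternating diagrams and checkerboard shadings *)

Section Checkerboard.
Variable D : diagram.
Implicit Types (v w : pt D) (S : {set dart D}).
Hypothesis sep : separated D.

(** Two turns lead to the other end of the same strand, and each turn changes the colour. *)
Lemma coloring_flip S v : coloring S -> ~~ plain v ->
  ((v, false) \in S) = ((v, true) \in S).
Proof.
move=> colS nv; have h d := coloring_turn d colS.
have hh d : (turn (turn d) \in S) = (d \in S) by rewrite !h negbK.
rewrite -[LHS]hh; case: (pointP v) nv => [c cC ->|c cC ->|-> //] _.
  by rewrite turn_over // turn_under //; case: (positive c).
by rewrite turn_under // turn_over //; case: (positive c).
Qed.

Lemma coloring_plain S v : coloring S -> plain v ->
  ((v, false) \in S) = ((v, true) \notin S).
Proof. by move=> colS pv; rewrite -(coloring_turn _ colS) turn_plain. Qed.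

Lemma coloring_nxt S v : coloring S ->
  ((nxt D v, true) \in S) = ((v, true) \in S) (+) ~~ plain (nxt D v).
Proof.
move=> colS; have := colS.2 (v, true); rewrite /opp /=.
have [pv|nv] := boolP (plain (nxt D v)).
  by rewrite coloring_plain // addbF => /negb_inj.
by rewrite coloring_flip // => ->; rewrite addbT.
Qed.

Lemma coloring_under S c : coloring S -> c \in crossings D ->
  ((under c, true) \in S) = ((over c, true) \notin S).
Proof.
move=> colS cC; rewrite -(coloring_turn _ colS) turn_over //.
case: (positive c) => //=; rewrite coloring_flip //.
by rewrite (not_plain sep false).
Qed.

Lemma checkerboard_over S v : checkerboard S -> ~~ plain v ->
  ((v, true) \in S) = is_over v.
Proof.
case=> h1 h2 h3; have colS : coloring S by [].
case: (pointP v) => [c cC ->|c cC ->|-> //] _.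
  by rewrite (is_over_strand sep true) // h3.
by rewrite (is_over_strand sep false) // coloring_under // h3.
Qed.

(** The colour on the left of a strand records its level at a crossing, is kept at plain points and
    changes at each crossing. *)
Lemma checkerboard_alternating S : checkerboard S -> alternating D.
Proof.
move=> chS v n w nv nw pl; have [h1 h2 _] := chS; have colS : coloring S by [].
rewrite -(checkerboard_over chS nw) -(checkerboard_over chS nv) /w iterS.
rewrite coloring_nxt // -iterS nw addbT; congr (~~ _).
have : (n <= n)%N by []; elim: {-2}n => // m IHm mn.
by rewrite iterS coloring_nxt // -iterS pl //= addbF IHm // ltnW.
Qed.

Lemma alternating_checkerboard : planar_connected D -> alternating D ->
  exists S, checkerboard S.
Proof.
case=> pl p1 alt; have [S colS] := planar_coloring sep pl p1.
have [C0|[c0 c0C]] := set_0Vmem (crossings D).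
  by exists S; case: colS => h1 h2; split=> // c; rewrite C0 inE.
(* One of two complementary colourings is correct at [c0]; correctness then spreads from there over
   the connected diagram. *)
wlog ov0 : S colS / (over c0, true) \in S.
  have [h|h] := boolP ((over c0, true) \in S); first exact: (fun H => H S colS h).
  by move=> H; apply: (H (~: S)); [apply: coloringC | rewrite inE].
exists S; have [h1 h2] := colS; split=> // c cC b.
suff : (over c, true) \in S.
  by case: b => //; rewrite coloring_flip // (not_plain sep true).
pose good v := ((v, true) \in S) = is_over v.
(* The equation [good] carries no information at plain points, so the invariant refers to the last
   crossing point before [v]. *)
pose Z v := exists n w, [/\ v = iter n (nxt D) w, ~~ plain w, good w &
   forall m, (0 < m <= n)%N -> plain (iter m (nxt D) w)].
have goodZ v : good v -> ~~ plain v -> Z v.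
  by move=> gv nv; exists 0%N, v; split=> // -[|m].
have Zgood v : Z v -> ~~ plain v -> good v.
  move=> [[|n] [w [-> nw gw plw]]]; first by [].
  by rewrite (plw n.+1) /=.
have np b' c' : c' \in crossings D -> ~~ plain (strand_at b' c').
  by move=> c'C; rewrite (not_plain sep).
have goodE c' : c' \in crossings D -> good (over c') <-> good (under c').
  move=> c'C; rewrite /good (is_over_strand sep true c'C).
  rewrite (is_over_strand sep false c'C) coloring_under //.
  by case: ((over c', true) \in S).
have stZ : strand_stable Z.
  split=> [v [n [w [-> nw gw plw]]]|c' c'C].
    have [pv|nv] := boolP (plain (nxt D (iter n (nxt D) w))).
      exists n.+1, w; split=> // m /andP[m0]; rewrite leq_eqVlt => /predU1P[->|] //.
      by move=> mn; apply: plw; rewrite m0.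
    apply: goodZ => //; rewrite /good coloring_nxt // nv addbT (alt w n nw nv plw).
    rewrite -gw; congr (~~ _).
    have : (n <= n)%N by []; elim: {-2}n => // m IHm mn.
    by rewrite iterS coloring_nxt // -iterS plw //= addbF IHm // ltnW.
  split=> /Zgood h; apply: goodZ; try exact: (np true); try exact: (np false).
    by apply/goodE => //; apply: h; apply: (np true).
  by apply/goodE => //; apply: h; apply: (np false).
have [_ conn] := (pieces1P D).1 p1.
have : Z (over c).
  apply: (conn _ stZ (over c0)); apply: goodZ; last exact: (np true).
  by rewrite /good (is_over_strand sep true) // ov0.
by move/Zgood => /(_ (np true c cC)); rewrite /good (is_over_strand sep true).
Qed.

(* The color changes at each crossing of the strand; a connected diagram with a
   strand without crossings has no crossing, and then both shadings are allowed. *)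
Lemma recolor_strand S v b : planar_connected D -> checkerboard S ->
  exists k S1, checkerboard S1 /\ ((iter k (nxt D) v, true) \in S1) = b.
Proof.
move=> [pl p1] chS; have [h1 h2 h3] := chS; have colS : coloring S by [].
have [k /eqP hk|nk] := pickP (fun k : 'I_(fingraph.order (nxt D) v) =>
    ((iter k (nxt D) v, true) \in S) == b); first by exists k, S.
have hZ k : ((iter k (nxt D) v, true) \in S) = ~~ b.
  have := nk (Ordinal (ltn_pmod k (fingraph.order_gt0 (nxt D) v))); rewrite /=.
  have -> : iter (k %% fingraph.order (nxt D) v) (nxt D) v = iter k (nxt D) v.
    rewrite [in RHS](divn_eq k (fingraph.order (nxt D) v)) addnC iterD.
    congr (iter _ _ _); elim: (k %/ _)%N => // q IHq.
    by rewrite mulSn addnC iterD iter_order //; apply: perm_inj.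
  by case: (_ \in S); case: b {nk}.
pose Z w := exists k, w = iter k (nxt D) v.
have Zplain w : Z w -> plain w.
  move=> [k ->]; case: (posnP k) => [->|]; last first.
    case: k => // k _; have := coloring_nxt (iter k (nxt D) v) colS.
    rewrite -iterS !hZ; case: (plain _) => //; by case: b {nk hZ}.
  (* For [k = 0], the point before [v] is found by going round the whole component. *)
  have := coloring_nxt (iter (fingraph.order (nxt D) v).-1 (nxt D) v) colS.
  rewrite -iterS prednK ?fingraph.order_gt0 // iter_order; last exact: perm_inj.
  rewrite hZ -[v]/(iter 0 (nxt D) v) hZ /=; case: (plain _) => //; by case: b {nk hZ}.
have stZ : strand_stable Z.
  split=> [w [k ->]|c cC]; first by exists k.+1.
  split=> /Zplain; [rewrite (not_plain sep true)|rewrite (not_plain sep false)] => //.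
have [_ conn] := (pieces1P D).1 p1.
have C0 : {in crossings D, forall c, False}.
  move=> c cC; have : Z (over c) by apply: (conn _ stZ v); exists 0%N.
  by move/Zplain; rewrite (not_plain sep true).
exists 0%N, (~: S); have [h1' h2'] := coloringC colS; split.
  by split=> // c /C0.
by rewrite inE (hZ 0%N) negbK.
Qed.

End Checkerboard.

(** * Wedges of plane digraphs *)

(** Common form of [joined] and [same_side], so that one statement about wedges serves both the
    digraph and its dual. *)
Definition edge_connect (A X : finType) (s t : A -> X) (Z : {set A}) : rel X :=
  connect [rel a b | [exists e in Z,
     ((s e == a) && (t e == b)) || ((s e == b) && (t e == a))]].

Section EdgeConnect.
Variables (A X : finType) (s t : A -> X) (Z : {set A}).

Lemma edge_connect_edge e : e \in Z -> edge_connect s t Z (s e) (t e).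
Proof. by move=> eZ; apply/connect1/existsP; exists e; rewrite eZ !eqxx. Qed.

Lemma edge_connect_sym : ssrbool.symmetric (edge_connect s t Z).
Proof.
apply: sym_connect_sym => x y; apply/eq_existsb => e /=.
by rewrite orbC.
Qed.

Lemma edge_connect_ind (Q : X -> Prop) x y :
  (forall e, e \in Z -> Q (s e) <-> Q (t e)) ->
  edge_connect s t Z x y -> Q x -> Q y.
Proof.
move=> h /connectP[p pth ->] {y}; elim: p x pth => //= y p IHp x.
case/andP=> /existsP[e /andP[eZ exy]] pth Qx; apply: IHp => //.
by case/orP: exy => /andP[/eqP e1 /eqP e2]; have := h e eZ; rewrite e1 e2; tauto.
Qed.
End EdgeConnect.

Lemma edge_connect_map (A X B Y : finType) (s t : A -> X) (s' t' : B -> Y)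
    (Z : {set A}) (Z' : {set B}) (f : X -> Y) x y :
  (forall e, e \in Z -> edge_connect s' t' Z' (f (s e)) (f (t e))) ->
  edge_connect s t Z x y -> edge_connect s' t' Z' (f x) (f y).
Proof.
move=> h xy; apply: (edge_connect_ind (Q := fun y => edge_connect s' t' Z' (f x) (f y)) _ xy).
  move=> e eZ; have st := h e eZ; split=> xe; apply: connect_trans xe _ => //.
  by rewrite -/(edge_connect _ _ _ _ _) edge_connect_sym.
exact: connect0.
Qed.

Section Wedge.
Variables (A A' B X X' Y : finType).
Variables (s t : A -> X) (s' t' : A' -> X') (S T : B -> Y).
Variables (i : A -> B) (j : A' -> B) (f : X -> Y) (f' : X' -> Y) (g : Y -> X).
Variables (x0 : X) (V : {set X}) (V' : {set X'}) (Z : {set A}) (Z' : {set A'}).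
Hypothesis si : {in Z, forall e, S (i e) = f (s e)}.
Hypothesis ti : {in Z, forall e, T (i e) = f (t e)}.
Hypothesis sj : {in Z', forall e, S (j e) = f' (s' e)}.
Hypothesis tj : {in Z', forall e, T (j e) = f' (t' e)}.
Hypothesis sV : {in Z, forall e, s e \in V}.
Hypothesis tV : {in Z, forall e, t e \in V}.
Hypothesis sV' : {in Z', forall e, s' e \in V'}.
Hypothesis tV' : {in Z', forall e, t' e \in V'}.
Hypothesis gf : {in V, forall x, g (f x) = x}.
Hypothesis gf' : {in V', forall x, g (f' x) = x0}.

(* [g] retracts the wedge onto the first graph. *)
Lemma edge_connect_wedge : {in V &, forall x y,
  edge_connect S T (i @: Z :|: j @: Z') (f x) (f y) = edge_connect s t Z x y}.
Proof.
move=> x y xV yV; apply/idP/idP => [xy|].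
  rewrite -(gf xV) -(gf yV); apply: edge_connect_map xy => e.
  case/setUP => /imsetP[e0 e0Z ->].
    by rewrite si // ti // !gf ?sV ?tV //; apply: edge_connect_edge.
  by rewrite sj // tj // !gf' ?sV' ?tV' //; apply: connect0.
apply: edge_connect_map => e eZ; rewrite -si // -ti //.
by apply: edge_connect_edge; rewrite inE imset_f.
Qed.
End Wedge.

(** The maps [f] and [k] carry vertices and faces into [H]. Their inverses [g] and [l] are required
    only on actual vertices and faces, since the ambient types contain more. *)
Record wedge_summand (N A F NH AH FH : finType) (G : plane_digraph N A F)
  (H : plane_digraph NH AH FH) (r : N) (q : F)
  (i : A -> AH) (f : N -> NH) (g : NH -> N) (k : F -> FH) (l : FH -> F) : Prop := {
  ws_inj : injective i;
  ws_tail : {in edges G, forall e, tail H (i e) = f (tail G e)};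
  ws_head : {in edges G, forall e, head H (i e) = f (head G e)};
  ws_lface : {in edges G, forall e, lface H (i e) = k (lface G e)};
  ws_rface : {in edges G, forall e, rface H (i e) = k (rface G e)};
  ws_epos : forall e, epos H (i e) = epos G e;
  ws_tailV : {in edges G, forall e, tail G e \in vertices G};
  ws_headV : {in edges G, forall e, head G e \in vertices G};
  ws_lfaceF : {in edges G, forall e, lface G e \in faces G};
  ws_rfaceF : {in edges G, forall e, rface G e \in faces G};
  ws_r : r \in vertices G;
  ws_q : q \in faces G;
  ws_gf : {in vertices G, forall x, g (f x) = x};
  ws_lk : {in faces G, forall x, l (k x) = x}
}.

(** The second digraph is drawn inside a face of the first and attached at the root, so the faces
    [q] and [q'] merge too and the dual graphs also form a wedge. The retractions collapse the other
    summand onto the root and onto the base face. *)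
Record wedge (N A F N' A' F' NH AH FH : finType) (G : plane_digraph N A F)
  (G' : plane_digraph N' A' F') (H : plane_digraph NH AH FH)
  (r : N) (q : F) (r' : N') (q' : F')
  (i : A -> AH) (f : N -> NH) (g : NH -> N) (k : F -> FH) (l : FH -> F)
  (i' : A' -> AH) (f' : N' -> NH) (g' : NH -> N') (k' : F' -> FH) (l' : FH -> F') : Prop := {
  w_l : wedge_summand G H r q i f g k l;
  w_r : wedge_summand G' H r' q' i' f' g' k' l';
  w_disj : forall e e', i e <> i' e';
  w_edges : edges H = i @: edges G :|: i' @: edges G';
  w_vertices : vertices H = f @: vertices G :|: f' @: vertices G';
  w_root : f r = f' r';
  w_base : k q = k' q';
  w_g : {in vertices G', forall x, g (f' x) = r};
  w_g' : {in vertices G, forall x, g' (f x) = r'};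
  w_l0 : {in faces G', forall x, l (k' x) = q};
  w_l' : {in faces G, forall x, l' (k x) = q'}
}.

Lemma wedge_sym (N A F N' A' F' NH AH FH : finType) (G : plane_digraph N A F)
  (G' : plane_digraph N' A' F') (H : plane_digraph NH AH FH)
  r q r' q' i f g k l i' f' g' k' l' :
  wedge G G' H r q r' q' i f g k l i' f' g' k' l' ->
  wedge G' G H r' q' r q i' f' g' k' l' i f g k l.
Proof.
case=> w1 w2 d e v ro ba h1 h2 h3 h4; split=> //.
- by move=> x y xy; apply: (d y x).
- by rewrite setUC.
- by rewrite setUC.
Qed.

Section WedgeLeft.
Variables (N A F N' A' F' NH AH FH : finType) (G : plane_digraph N A F).
Variables (G' : plane_digraph N' A' F') (H : plane_digraph NH AH FH).
Variables (r : N) (q : F) (r' : N') (q' : F').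
Variables (i : A -> AH) (f : N -> NH) (g : NH -> N) (k : F -> FH) (l : FH -> F).
Variables (i' : A' -> AH) (f' : N' -> NH) (g' : NH -> N') (k' : F' -> FH) (l' : FH -> F').
Hypothesis w : wedge G G' H r q r' q' i f g k l i' f' g' k' l'.
Let wl := w_l w.
Let wr := w_r w.

Lemma joined_wedge (Z : {set A}) (Z' : {set A'}) :
  Z \subset edges G -> Z' \subset edges G' -> {in vertices G &, forall x y,
  joined H (i @: Z :|: i' @: Z') (f x) (f y) = joined G Z x y}.
Proof.
move=> /subsetP ZE /subsetP Z'E.
apply: (edge_connect_wedge (s' := tail G') (t' := head G') (f' := f') (g := g)
  (x0 := r) (V' := vertices G')).
- by move=> e /ZE; apply: (ws_tail wl).
- by move=> e /ZE; apply: (ws_head wl).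
- by move=> e /Z'E; apply: (ws_tail wr).
- by move=> e /Z'E; apply: (ws_head wr).
- by move=> e /ZE; apply: (ws_tailV wl).
- by move=> e /ZE; apply: (ws_headV wl).
- by move=> e /Z'E; apply: (ws_tailV wr).
- by move=> e /Z'E; apply: (ws_headV wr).
- exact: ws_gf wl.
- exact: w_g w.
Qed.

Lemma wedge_meml e (Z : {set A}) (Z' : {set A'}) :
  (i e \in i @: Z :|: i' @: Z') = (e \in Z).
Proof.
rewrite inE (mem_imset _ _ (ws_inj wl)).
by case: imsetP => [[e' _ /(w_disj w)]|_]; rewrite ?orbF.
Qed.

Lemma wedge_memr e (Z : {set A}) (Z' : {set A'}) :
  (i' e \in i @: Z :|: i' @: Z') = (e \in Z').
Proof.
rewrite inE (mem_imset _ _ (ws_inj wr)).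
by case: imsetP => [[e' _ /esym /(w_disj w)]|_].
Qed.

Lemma wedge_setP (Y : {set AH}) (Z : {set A}) (Z' : {set A'}) :
  {subset Y <= i @: setT :|: i' @: setT} ->
  (forall e, (i e \in Y) = (e \in Z)) -> (forall e, (i' e \in Y) = (e \in Z')) ->
  Y = i @: Z :|: i' @: Z'.
Proof.
move=> YU hl hr; apply/setP => e; apply/idP/idP => [eY|].
  by have /setUP[/imsetP[e0 _ ee]|/imsetP[e0 _ ee]] := YU e eY;
    rewrite ee ?wedge_meml ?wedge_memr -?hl -?hr -ee.
by case/setUP => /imsetP[e0 e0Z ->]; rewrite ?hl ?hr.
Qed.

Lemma wedge_sub (Z : {set A}) (Z' : {set A'}) :
  {subset i @: Z :|: i' @: Z' <= i @: setT :|: i' @: setT}.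
Proof.
by move=> e; rewrite !inE => /orP[] /imsetP[e0 _ ->]; rewrite imset_f ?orbT.
Qed.

Lemma wedge_setD (Z1 Z2 : {set A}) (Z1' Z2' : {set A'}) :
  (i @: Z1 :|: i' @: Z1') :\: (i @: Z2 :|: i' @: Z2') =
  i @: (Z1 :\: Z2) :|: i' @: (Z1' :\: Z2').
Proof.
apply: wedge_setP => e; first by case/setDP => /wedge_sub.
  by rewrite in_setD !wedge_meml in_setD.
by rewrite in_setD !wedge_memr in_setD.
Qed.

Lemma wedge_setI (Z1 Z2 : {set A}) (Z1' Z2' : {set A'}) :
  (i @: Z1 :|: i' @: Z1') :&: (i @: Z2 :|: i' @: Z2') =
  i @: (Z1 :&: Z2) :|: i' @: (Z1' :&: Z2').
Proof.
apply: wedge_setP => e; first by case/setIP => /wedge_sub.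
  by rewrite in_setI !wedge_meml in_setI.
by rewrite in_setI !wedge_memr in_setI.
Qed.

Lemma card_wedge (P : pred AH) (Z : {set A}) (Z' : {set A'}) :
  #|[set e in i @: Z :|: i' @: Z' | P e]| =
  (#|[set e in Z | P (i e)]| + #|[set e in Z' | P (i' e)]|)%N.
Proof.
rewrite (@wedge_setP [set e in i @: Z :|: i' @: Z' | P e]
  [set e in Z | P (i e)] [set e in Z' | P (i' e)]).
- rewrite cardsU (card_imset _ (ws_inj wl)) (card_imset _ (ws_inj wr)).
  rewrite (_ : _ :&: _ = set0) ?cards0 ?subn0 //; apply/setP => e; rewrite !inE.
  by apply/andP => -[/imsetP[e1 _ ->] /imsetP[e2 _ /(w_disj w)]].
- by move=> e; rewrite inE => /andP[/wedge_sub].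
- by move=> e; rewrite inE wedge_meml inE.
- by move=> e; rewrite inE wedge_memr inE.
Qed.

Lemma pos_edges_wedge : pos_edges H = i @: pos_edges G :|: i' @: pos_edges G'.
Proof.
rewrite /pos_edges (w_edges w); apply: wedge_setP => e.
- by rewrite inE => /andP[/wedge_sub].
- by rewrite inE wedge_meml (ws_epos wl) inE.
- by rewrite inE wedge_memr (ws_epos wr) inE.
Qed.

Lemma neg_edges_wedge : neg_edges H = i @: neg_edges G :|: i' @: neg_edges G'.
Proof.
rewrite /neg_edges (w_edges w); apply: wedge_setP => e.
- by rewrite inE => /andP[/wedge_sub].
- by rewrite inE wedge_meml (ws_epos wl) inE.
- by rewrite inE wedge_memr (ws_epos wr) inE.
Qed.

Lemma wedge_setD1 e (Z : {set A}) (Z' : {set A'}) :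
  (i @: Z :|: i' @: Z') :\ i e = i @: (Z :\ e) :|: i' @: Z'.
Proof. by have := wedge_setD Z [set e] Z' set0; rewrite imset0 setU0 imset_set1 setD0. Qed.

Lemma cycle_edges_wedgel (Z : {set A}) (Z' : {set A'}) e :
  Z \subset edges G -> Z' \subset edges G' ->
  (i e \in cycle_edges H (i @: Z :|: i' @: Z')) = (e \in cycle_edges G Z).
Proof.
move=> ZE Z'E; rewrite !inE -in_setU wedge_meml wedge_setD1.
have [eZ|//] := boolP (e \in Z); have eE := subsetP ZE _ eZ.
rewrite (ws_tail wl) // (ws_head wl) // joined_wedge ?(ws_tailV wl) ?(ws_headV wl) //.
exact: subset_trans (subsetDl _ _) ZE.
Qed.

Lemma int_semi_active_wedge (Z : {set A}) (Z' : {set A'}) e :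
  Z \subset edges G -> Z' \subset edges G' -> e \in edges G ->
  int_semi_active H (f r) (i @: Z :|: i' @: Z') (i e) = int_semi_active G r Z e.
Proof.
move=> ZE Z'E eE; rewrite /int_semi_active wedge_setD1 (ws_tail wl) //.
rewrite joined_wedge ?(ws_tailV wl) ?(ws_r wl) //.
exact: subset_trans (subsetDl _ _) ZE.
Qed.

Lemma same_side_wedge (Z : {set A}) (Z' : {set A'}) : {in faces G &, forall x y,
  same_side H (i @: Z :|: i' @: Z') (k x) (k y) = same_side G Z x y}.
Proof.
rewrite /same_side (w_edges w) wedge_setD.
have ZE e : e \in edges G :\: Z -> e \in edges G by case/setDP.
have Z'E e : e \in edges G' :\: Z' -> e \in edges G' by case/setDP.
apply: (edge_connect_wedge (s' := lface G') (t' := rface G') (f' := k') (g := l)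
  (x0 := q) (V' := faces G')).
- by move=> e /ZE; apply: (ws_lface wl).
- by move=> e /ZE; apply: (ws_rface wl).
- by move=> e /Z'E; apply: (ws_lface wr).
- by move=> e /Z'E; apply: (ws_rface wr).
- by move=> e /ZE; apply: (ws_lfaceF wl).
- by move=> e /ZE; apply: (ws_rfaceF wl).
- by move=> e /Z'E; apply: (ws_lfaceF wr).
- by move=> e /Z'E; apply: (ws_rfaceF wr).
- exact: ws_lk wl.
- exact: w_l0 w.
Qed.

End WedgeLeft.

Section WedgeCycles.
Variables (N A F N' A' F' NH AH FH : finType) (G : plane_digraph N A F).
Variables (G' : plane_digraph N' A' F') (H : plane_digraph NH AH FH).
Variables (r : N) (q : F) (r' : N') (q' : F').
Variables (i : A -> AH) (f : N -> NH) (g : NH -> N) (k : F -> FH) (l : FH -> F).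
Variables (i' : A' -> AH) (f' : N' -> NH) (g' : NH -> N') (k' : F' -> FH) (l' : FH -> F').
Hypothesis w : wedge G G' H r q r' q' i f g k l i' f' g' k' l'.
Let w' := wedge_sym w.
Let wl := w_l w.

Lemma cycle_edges_wedge (Z : {set A}) (Z' : {set A'}) :
  Z \subset edges G -> Z' \subset edges G' ->
  cycle_edges H (i @: Z :|: i' @: Z') = i @: cycle_edges G Z :|: i' @: cycle_edges G' Z'.
Proof.
move=> ZE Z'E; apply: (wedge_setP w) => e.
- by rewrite inE => /andP[/wedge_sub].
- exact: (cycle_edges_wedgel w).
- by rewrite setUC (cycle_edges_wedgel w').
Qed.

(** As [Z'] has no cycle, all cycle edges come from [G]. The faces of [G'] are attached at the base
    face, so they do not affect which faces of [G] lie on the side of [q]. *)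
Lemma ext_semi_active_wedge (Z : {set A}) (Z' : {set A'}) e :
  Z \subset edges G -> Z' \subset edges G' -> cycle_edges G' Z' = set0 -> e \in edges G ->
  ext_semi_active H (k q) (i @: Z :|: i' @: Z') (i e) = ext_semi_active G q Z e.
Proof.
move=> ZE Z'E Z'0 eE; rewrite /ext_semi_active /Cyc setUA -imsetU1.
rewrite cycle_edges_wedge //; last by rewrite subUset sub1set eE.
by rewrite (ws_lface wl) // (same_side_wedge w) ?(ws_lfaceF wl) ?(ws_q wl).
Qed.

End WedgeCycles.

Section WedgeTrees.
Variables (N A F N' A' F' NH AH FH : finType) (G : plane_digraph N A F).
Variables (G' : plane_digraph N' A' F') (H : plane_digraph NH AH FH).
Variables (r : N) (q : F) (r' : N') (q' : F').
Variables (i : A -> AH) (f : N -> NH) (g : NH -> N) (k : F -> FH) (l : FH -> F).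
Variables (i' : A' -> AH) (f' : N' -> NH) (g' : NH -> N') (k' : F' -> FH) (l' : FH -> F').
Hypothesis w : wedge G G' H r q r' q' i f g k l i' f' g' k' l'.
Let w' := wedge_sym w.
Let wl := w_l w.
Let wr := w_r w.

Lemma spanning_tree_wedge (Z : {set A}) (Z' : {set A'}) :
  Z \subset edges G -> Z' \subset edges G' ->
  spanning_tree H (i @: Z :|: i' @: Z') = spanning_tree G Z && spanning_tree G' Z'.
Proof.
move=> ZE Z'E; rewrite /spanning_tree ZE Z'E (cycle_edges_wedge w) //.
have -> : i @: Z :|: i' @: Z' \subset edges H.
  by rewrite (w_edges w); apply: setUSS; apply: imsetS.
rewrite setU_eq0 !imset_eq0 /=; rewrite andbACA; congr (_ && _).
have jl := joined_wedge w ZE Z'E.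
have jr x y : x \in vertices G' -> y \in vertices G' ->
    joined H (i @: Z :|: i' @: Z') (f' x) (f' y) = joined G' Z' x y.
  by move=> xV yV; rewrite setUC (joined_wedge w').
apply/idP/andP => [/forall_inP h|[/forall_inP h /forall_inP h']].
  split; apply/forall_inP => x xV; apply/forall_inP => y yV.
    by rewrite -jl //; apply: (forall_inP (h _ _)); rewrite (w_vertices w) inE imset_f.
  by rewrite -jr //; apply: (forall_inP (h _ _)); rewrite (w_vertices w) inE imset_f ?orbT.
(* Any two vertices of the wedge are joined through the common root. *)
have toroot x : x \in vertices H -> joined H (i @: Z :|: i' @: Z') x (f r).
  rewrite (w_vertices w) => /setUP[] /imsetP[x0 x0V ->].
    by rewrite jl ?(ws_r wl) //; apply: (forall_inP (h _ x0V)); apply: ws_r wl.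
  by rewrite (w_root w) jr ?(ws_r wr) //; apply: (forall_inP (h' _ x0V)); apply: ws_r wr.
apply/forall_inP => x xV; apply/forall_inP => y yV.
apply: connect_trans (toroot x xV) _.
by have := toroot y yV; rewrite [joined _ _ _ _](@edge_connect_sym _ _ (tail H) (head H)).
Qed.

Local Open Scope ring_scope.

(** The parameter [b] is [id] for the semi-active edges and [negb] for the semi-passive ones. *)
Lemma iota_wedge (b : bool -> bool) (Z : {set A}) (Z' : {set A'}) :
  Z \subset edges G -> Z' \subset edges G' ->
  #|[set e in (i @: Z :|: i' @: Z') :&: pos_edges H |
      b (int_semi_active H (f r) (i @: Z :|: i' @: Z') e)]| =
  (#|[set e in Z :&: pos_edges G | b (int_semi_active G r Z e)]| +
   #|[set e in Z' :&: pos_edges G' | b (int_semi_active G' r' Z' e)]|)%N.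
Proof.
move=> ZE Z'E; rewrite (pos_edges_wedge w) (wedge_setI w) (card_wedge w).
congr (_ + _)%N; apply: eq_card => e; rewrite !inE; apply: andb_id2l => /andP[eZ _].
  by rewrite (int_semi_active_wedge w) //; apply: subsetP eZ.
by rewrite setUC (w_root w) (int_semi_active_wedge w') //; apply: subsetP eZ.
Qed.

Lemma eps_wedge (b : bool -> bool) (Z : {set A}) (Z' : {set A'}) :
  Z \subset edges G -> Z' \subset edges G' ->
  cycle_edges G Z = set0 -> cycle_edges G' Z' = set0 ->
  #|[set e in neg_edges H :\: (i @: Z :|: i' @: Z') |
      b (ext_semi_active H (k q) (i @: Z :|: i' @: Z') e)]| =
  (#|[set e in neg_edges G :\: Z | b (ext_semi_active G q Z e)]| +
   #|[set e in neg_edges G' :\: Z' | b (ext_semi_active G' q' Z' e)]|)%N.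
Proof.
move=> ZE Z'E Z0 Z'0; rewrite (neg_edges_wedge w) (wedge_setD w) (card_wedge w).
congr (_ + _)%N; apply: eq_card => e; rewrite !inE; apply: andb_id2l => /and3P[_ eE _].
  by rewrite (ext_semi_active_wedge w).
by rewrite setUC (w_base w) (ext_semi_active_wedge w').
Qed.

Let wedge_pair (p : {set A} * {set A'}) : {set AH} := i @: p.1 :|: i' @: p.2.

Lemma tree_polynomial_wedge :
  tree_polynomial H (f r) (k q) = tree_polynomial G r q * tree_polynomial G' r' q'.
Proof.
rewrite /tree_polynomial mulr_suml; under [RHS]eq_bigr do rewrite mulr_sumr.
rewrite pair_big_dep /=.
(* Taking preimages inverts [wedge_pair] on subsets of [edges H], in particular on spanning
   trees. *)
rewrite (reindex_onto wedge_pair (fun Z => (i @^-1: Z, i' @^-1: Z))); last first.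
  move=> Z /and3P[ZH _ _]; apply/esym/(wedge_setP w) => e; try by rewrite inE.
  by move/(subsetP ZH); rewrite (w_edges w) => /wedge_sub.
have pK p : (i @^-1: wedge_pair p, i' @^-1: wedge_pair p) = p.
  case: p => Z Z'; congr (_, _); apply/setP => e; rewrite inE.
    by rewrite (wedge_meml w).
  by rewrite (wedge_memr w).
under eq_bigl do rewrite pK eqxx andbT.
have edgesP (p : {set A} * {set A'}) : (p.1 \subset edges G) && (p.2 \subset edges G') =
    (wedge_pair p \subset edges H).
  rewrite (w_edges w); apply/andP/idP => [[h1 h2]|/subsetP h].
    by apply: setUSS; apply: imsetS.
  split; apply/subsetP => e ep.
    by rewrite -(wedge_meml w e _ (edges G')) h // (wedge_meml w).
  by rewrite -(wedge_memr w e (edges G)) h // (wedge_memr w).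
apply: eq_big => [p|p /and3P[]].
  apply/idP/idP => [sp|/andP[sp1 sp2]].
    have /andP[h1 h2] : (p.1 \subset edges G) && (p.2 \subset edges G').
      by rewrite edgesP; case/and3P: sp.
    by rewrite -spanning_tree_wedge.
  have h1 : p.1 \subset edges G by case/and3P: sp1.
  have h2 : p.2 \subset edges G' by case/and3P: sp2.
  by rewrite /wedge_pair spanning_tree_wedge // sp1.
rewrite -edgesP => /andP[h1 h2] _.
rewrite (cycle_edges_wedge w) // setU_eq0 !imset_eq0 => /andP[/eqP c1 /eqP c2].
have -> : iota_act H (f r) (wedge_pair p) = (iota_act G r p.1 + iota_act G' r' p.2)%N.
  exact: (iota_wedge id).
have -> : iota_pas H (f r) (wedge_pair p) = (iota_pas G r p.1 + iota_pas G' r' p.2)%N.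
  exact: (iota_wedge negb).
have -> : eps_act H (k q) (wedge_pair p) = (eps_act G q p.1 + eps_act G' q' p.2)%N.
  exact: (eps_wedge id).
have -> : eps_pas H (k q) (wedge_pair p) = (eps_pas G q p.1 + eps_pas G' q' p.2)%N.
  exact: (eps_wedge negb).
by rewrite !exprD [X in X * _ * _ = _]mulrACA [X in X * _ = _]mulrACA [LHS]mulrACA.
Qed.

End WedgeTrees.

(** * The Tait digraph of a connected sum *)

Section Transport.
Variables (D E : diagram) (m : dart D -> dart E).

(** Regions are sets of darts, so a map of darts acts on them through a representative; under
    [m_region] the choice does not matter. *)
Definition push_region (R : {set dart D}) : {set dart E} :=
  if [pick d in R] is Some d then region (m d) else set0.

(** The default [R0] will be the root or base region of a summand, onto which the retraction sends
    the regions that this summand does not meet. *)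
Definition pull_region (R0 : {set dart D}) (R : {set dart E}) : {set dart D} :=
  if [pick d | m d \in R] is Some d then region d else R0.

Hypotheses (sepD : separated D) (sepE : separated E).
Hypothesis m_region : forall d e, (region (m d) == region (m e)) = (region d == region e).

Lemma push_regionE d : push_region (region d) = region (m d).
Proof.
rewrite /push_region; case: pickP => [e|/(_ d)]; last by rewrite inE connect0.
by rewrite inE -region_eq // -m_region => /eqP.
Qed.

Lemma pull_regionE R0 d : pull_region R0 (region (m d)) = region d.
Proof.
rewrite /pull_region; case: pickP => [e|/(_ d)]; last by rewrite inE connect0.
by rewrite inE -region_eq // m_region => /eqP.
Qed.

Lemma pull_region_out R0 u :
  (forall d, region (m d) = region u -> region d = R0) -> pull_region R0 (region u) = R0.
Proof.
move=> h; rewrite /pull_region; case: pickP => // e.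
by rewrite inE -region_eq // => /eqP /esym /h.
Qed.
End Transport.

(** Together with [opp], it names the shaded and the unshaded region along the strand leaving [v],
    which serve as root and base face. *)
Definition shaded_side (D : diagram) (S : {set dart D}) (v : pt D) : dart D :=
  if (v, true) \in S then (v, true) else opp (v, true).

Section Adjacent.
Variables (D : diagram) (S : {set dart D}) (v : pt D).
Hypotheses (pD : planar_connected D) (chS : checkerboard S).
Let sep := planar_separated pD.1.
Let colS : coloring S. Proof. by case: chS. Qed.
Local Notation x := (shaded_side S v).

Lemma shaded_sideP : x \in S.
Proof.
rewrite /shaded_side; case: ifP => // /negbT nv; by rewrite colS.2.
Qed.

Lemma shaded_vertex : region x \in vertices (tait S).
Proof. by apply: imset_f; apply: shaded_sideP. Qed.

Lemma shaded_face : region (opp x) \in faces (tait S).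
Proof. by apply: imset_f; rewrite inE colS.2 negbK shaded_sideP. Qed.

(** Following the strand back from [v] to the last crossing point [u] keeps both regions, since only
    plain points are passed, and the edge through that crossing has one region as an end and the
    other as a side. Without crossings the digraph has no edge. *)
Lemma shaded_adjacent : adjacent (tait S) (region x) (region (opp x)).
Proof.
rewrite /adjacent; have [C0|[c0 c0C]] := set_0Vmem (crossings D).
  by rewrite (C0 : edges (tait S) = set0) eqxx.
apply/orP; right.
pose Z w := exists n u, [/\ w = iter n (nxt D) u, ~~ plain u &
   forall m, (0 < m <= n)%N -> plain (iter m (nxt D) u)].
have Z0 w : ~~ plain w -> Z w by move=> nw; exists 0%N, w; split=> // -[].
have npo c : c \in crossings D -> ~~ plain (over c).
  by move=> cC; rewrite (not_plain sep true).
have npu c : c \in crossings D -> ~~ plain (under c).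
  by move=> cC; rewrite (not_plain sep false).
have stZ : strand_stable Z.
  split=> [w [n [u [-> nu plu]]]|c cC].
    have [pw|nw] := boolP (plain (nxt D (iter n (nxt D) u))); last exact: Z0.
    exists n.+1, u; split=> // m /andP[m0]; rewrite leq_eqVlt => /predU1P[->|] //.
    by move=> mn; apply: plu; rewrite m0.
  by split=> _; apply: Z0; [apply: npu | apply: npo].
have [n [u [ev nu plu]]] : Z v.
  by apply: ((pieces1P D).1 pD.2).2 stZ (over c0) v _; apply: Z0; apply: npo.
have regs m : (m <= n)%N -> region (iter m (nxt D) u, true) = region (u, true) /\
    region (opp (iter m (nxt D) u, true)) = region (opp (u, true)).
  elim: m => // m IHm mn; have [<- <-] := IHm (ltnW mn).
  have pw : plain (nxt D (iter m (nxt D) u)) by apply: (plu m.+1).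
  have oe : opp (iter m (nxt D) u, true) = (nxt D (iter m (nxt D) u), false) by [].
  have tp : turn (nxt D (iter m (nxt D) u), false) = (nxt D (iter m (nxt D) u), true).
    by rewrite turn_plain.
  split; first by rewrite iterS -tp region_turn // -oe oppK.
  by rewrite iterS -region_turn // turn_plain // oe.
have [r1 r2] := regs n (leqnn _); rewrite -ev in r1 r2.
have uv : ((v, true) \in S) = ((u, true) \in S) by apply: coloring_region r1.
case: (pointP u) => [c cC eu|c cC eu|pu]; last by rewrite pu in nu.
  apply/existsP; exists c; rewrite {1}/tait /= cC /shaded_side uv eu.
  have [_ _ h3] := chS; rewrite h3 // r1 r2 eu -region_turn // turn_over //= !inE eqxx.
  by rewrite eqxx !orbT.
apply/existsP; exists c; rewrite {1}/tait /= cC /shaded_side uv eu.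
have [_ _ h3] := chS; rewrite (coloring_under sep colS cC) h3 //=.
rewrite oppK r1 r2 eu -region_turn // turn_under //= !inE.
by case: (positive c); rewrite /= !eqxx ?orbT.
Qed.
End Adjacent.

Section TaitSum.
Variables (D D' : diagram) (v : pt D) (v' : pt D').
Variables (S : {set dart D}) (S' : {set dart D'}).
Hypotheses (pD : planar_connected D) (pD' : planar_connected D').
Hypotheses (chS : checkerboard S) (chS' : checkerboard S').
Hypothesis matched : ((v, true) \in S) = ((v', true) \in S').
Let DS := diagram_sum v v'.
Let pDS : planar_connected DS := planar_sum v v' pD pD'.
Let sep := planar_separated pD.1.
Let sep' := planar_separated pD'.1.
Let sepS := planar_separated pDS.1.
Let colS : coloring S. Proof. by case: chS. Qed.
Let colS' : coloring S'. Proof. by case: chS'. Qed.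
Local Notation dl := (dartl v v').
Local Notation dr := (dartr v v').

Definition shading_sum : {set dart DS} :=
  [set d : dart DS | match d.1 with inl w => (w, d.2) \in S | inr w => (w, d.2) \in S' end].
Local Notation SS := shading_sum.

Lemma shading_suml d : (dl d \in SS) = (d \in S).
Proof. by case: d => w b; rewrite inE. Qed.

Lemma shading_sumr d : (dr d \in SS) = (d \in S').
Proof. by case: d => w b; rewrite inE. Qed.

Lemma dart_sumP (d : dart DS) : (exists e, d = dl e) \/ (exists e, d = dr e).
Proof. by case: d => [[w|w] b]; [left | right]; exists (w, b). Qed.

Lemma checkerboard_sum : checkerboard SS.
Proof.
have turnS d : (turn d \in SS) = (d \notin SS).
  case: (dart_sumP d) => [] [e ->].
    by rewrite turn_suml // !shading_suml coloring_turn.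
  by rewrite turn_sumr // !shading_sumr coloring_turn.
have omatched : (opp (v, true) \in S) = (opp (v', true) \in S').
  by rewrite colS.2 colS'.2 matched.
have nextS d : (next_dart d \in SS) = (d \in SS).
  case: (dart_sumP d) => [] [e ->].
    have [->|n1] := eqVneq e (cutl v).
      by rewrite next_cutl // shading_suml shading_sumr colS'.1.
    have [->|n2] := eqVneq e (opp (cutl v)).
      by rewrite next_opp_cutl // shading_suml shading_sumr colS'.1.
    by rewrite next_suml // !shading_suml colS.1.
  have [->|n1] := eqVneq e (cutr v').
    by rewrite next_cutr // shading_suml shading_sumr colS.1.
  have [->|n2] := eqVneq e (opp (cutr v')).
    by rewrite next_opp_cutr // shading_suml shading_sumr colS.1.
  by rewrite next_sumr // !shading_sumr colS'.1.
split=> // [d|c /crossings_sumP[] [c0 c0C ->] b].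
- by rewrite -[in RHS]nextS /next_dart turnS negbK.
- by have [_ _ h] := chS; rewrite (shading_suml (over c0, b)) h.
- by have [_ _ h] := chS'; rewrite (shading_sumr (over c0, b)) h.
Qed.

Let sidel := planar_sides (cutl v) pD.
Let sider := planar_sides (cutr v') pD'.
Let rl := @region_suml _ _ v v' sep sep' sider.
Let rr := @region_sumr _ _ v v' sep sep' sidel.
Let rx := @region_sum_cross _ _ v v' sep sep' sider.
Local Notation x := (shaded_side S v).
Local Notation x' := (shaded_side S' v').

(** Regions are merged only along the cut, and [matched] ensures that the shaded sides of the two
    strands meet each other, whichever direction they face. *)
Let cross_shaded d d' : region (dl d) = region (dr d') -> d \in S ->
  region d = region x /\ region d' = region x'.
Proof.
move=> /eqP; rewrite rx /shaded_side -matched => /orP[] /andP[/eqP h /eqP ->] dS.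
  by rewrite -(coloring_region colS h) dS.
have := coloring_region colS h; rewrite dS colS.2 => /esym/negbTE nv.
by rewrite nv.
Qed.

Let cross_unshaded d d' : region (dl d) = region (dr d') -> d \notin S ->
  region d = region (opp x) /\ region d' = region (opp x').
Proof.
move=> /eqP; rewrite rx /shaded_side -matched => /orP[] /andP[/eqP h /eqP ->] dS.
  have := coloring_region colS h; rewrite (negbTE dS) => /esym nv.
  by rewrite nv !oppK.
have := coloring_region colS h; rewrite (negbTE dS) colS.2 => /esym/negbFE nv.
by rewrite nv.
Qed.

Let cross_color d d' : region (dl d) = region (dr d') -> (d \in S) = (d' \in S').
Proof.
move/(coloring_region (S := SS)); rewrite shading_suml shading_sumr; apply.
by case: checkerboard_sum.
Qed.

Let cross_root : region (dl x) = region (dr x').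
Proof.
apply/eqP; rewrite rx /shaded_side -matched; case: ifP => _; by rewrite !eqxx ?orbT.
Qed.

Let cross_base : region (dl (opp x)) = region (dr (opp x')).
Proof.
by apply/eqP; rewrite rx /shaded_side -matched; case: ifP => _; rewrite ?oppK !eqxx ?orbT.
Qed.

Lemma wedge_sum : wedge (tait S) (tait S') (tait SS)
  (region x) (region (opp x)) (region x') (region (opp x'))
  (map_crossing inl) (push_region dl) (pull_region dl (region x))
    (push_region dl) (pull_region dl (region (opp x)))
  (map_crossing inr) (push_region dr) (pull_region dr (region x'))
    (push_region dr) (pull_region dr (region (opp x'))).
Proof.
have pl := push_regionE sep rl; have pr := push_regionE sep' rr.
split.
- split=> //; try by move=> e _; rewrite pl.
  + by apply: map_crossing_inj => ? ? [].
  + by move=> e eC; apply: imset_f; have [_ _ ->] := chS.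
  + by move=> e eC; apply: imset_f; have [_ _ ->] := chS.
  + move=> e eC; apply: imset_f; rewrite inE.
    have := coloring_under sep colS eC; have [_ _ ->] := chS => //= nu.
    by case: (positive e); rewrite ?nu // coloring_flip ?nu // (not_plain sep false).
  + move=> e eC; apply: imset_f; rewrite inE.
    have := coloring_under sep colS eC; have [_ _ ->] := chS => //= nu.
    by case: (positive e); rewrite ?nu // coloring_flip ?nu // (not_plain sep false).
  + exact: shaded_vertex.
  + exact: shaded_face.
  + by move=> R /imsetP[d _ ->]; rewrite pl pull_regionE.
  + by move=> R /imsetP[d _ ->]; rewrite pl pull_regionE.
- split=> //; try by move=> e _; rewrite pr.
  + by apply: map_crossing_inj => ? ? [].
  + by move=> e eC; apply: imset_f; have [_ _ ->] := chS'.
  + by move=> e eC; apply: imset_f; have [_ _ ->] := chS'.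
  + move=> e eC; apply: imset_f; rewrite inE.
    have := coloring_under sep' colS' eC; have [_ _ ->] := chS' => //= nu.
    by case: (positive e); rewrite ?nu // coloring_flip ?nu // (not_plain sep' false).
  + move=> e eC; apply: imset_f; rewrite inE.
    have := coloring_under sep' colS' eC; have [_ _ ->] := chS' => //= nu.
    by case: (positive e); rewrite ?nu // coloring_flip ?nu // (not_plain sep' false).
  + exact: shaded_vertex.
  + exact: shaded_face.
  + by move=> R /imsetP[d _ ->]; rewrite pr pull_regionE.
  + by move=> R /imsetP[d _ ->]; rewrite pr pull_regionE.
- by move=> [[a b] s] [[a' b'] s'] [].
- by [].
- apply/setP => R; apply/imsetP/setUP => [[d dS ->]|[]/imsetP[R0 /imsetP[d dS ->] ->]].
  + case: (dart_sumP d) dS => [] [e ->]; rewrite ?shading_suml ?shading_sumr => eS.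
      by left; rewrite -pl; apply: imset_f; apply: imset_f.
    by right; rewrite -pr; apply: imset_f; apply: imset_f.
  + by exists (dl d); rewrite ?shading_suml ?pl.
  + by exists (dr d); rewrite ?shading_sumr ?pr.
- by rewrite pl pr cross_root.
- by rewrite pl pr cross_base.
- move=> R /imsetP[d dS ->]; rewrite pr; apply: pull_region_out => // e h.
  by case: (cross_shaded h); rewrite ?(cross_color h).
- move=> R /imsetP[d dS ->]; rewrite pl; apply: pull_region_out => // e /esym h.
  by case: (cross_shaded h).
- move=> R /imsetP[d]; rewrite inE => dS ->; rewrite pr; apply: pull_region_out => // e h.
  by case: (cross_unshaded h); rewrite ?(cross_color h).
- move=> R /imsetP[d]; rewrite inE => dS ->; rewrite pl; apply: pull_region_out => // e /esym h.
  by case: (cross_unshaded h).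
Qed.

Lemma tree_polynomial_sum : let y := shaded_side SS (inl v) in
  tree_polynomial (tait SS) (region y) (region (opp y)) =
  (tree_polynomial (tait S) (region x) (region (opp x)) *
   tree_polynomial (tait S') (region x') (region (opp x')))%R.
Proof.
rewrite /= -(tree_polynomial_wedge wedge_sum) !push_regionE //; congr (tree_polynomial _ _ _).
  rewrite /shaded_side (shading_suml (v, true)); case: ifP => _ //.
  (* After the cut, the far end of the strand leaving [inl v] belongs to [D']; its region is the one
     merged with the region of [opp (v, true)]. *)
  have -> : opp ((inl v, true) : dart DS) = dr (opp (v', true)).
    by rewrite /opp /= nxt_suml eqxx.
  by apply/esym/eqP; rewrite rx !eqxx orbT.
rewrite /shaded_side (shading_suml (v, true)); case: ifP => _; last by rewrite !oppK.
have -> : opp ((inl v, true) : dart DS) = dr (opp (v', true)).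
  by rewrite /opp /= nxt_suml eqxx.
by apply/esym/eqP; rewrite rx !eqxx orbT.
Qed.
End TaitSum.

(** * Multiplicativity of the invariant *)

Lemma invariantE P (K : link) D (S : {set dart D}) (v : pt D) :
  is_polynomial_invariant P -> planar_connected D -> same_link D K -> checkerboard S ->
  P K = tree_polynomial (tait S) (region (shaded_side S v)) (region (opp (shaded_side S v))).
Proof.
move=> hP pD DK chS.
apply: (hP K D S) => //.
- by split; [exact: pD.1 |].
- exact: (checkerboard_alternating (planar_separated pD.1) chS).
- exact: shaded_vertex.
- exact: shaded_face.
- exact: shaded_adjacent.
Qed.

Lemma diagram_planar_connected (K : link) D : is_diagram_of D K -> planar_connected D.
Proof. by case=> pl DK; split=> //; apply: (link_nonsplit pl DK). Qed.

Lemma diagram_nonsplit (K : link) D : same_link D K -> nonsplit D.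
Proof.
move=> DK E plE ED; apply: (link_nonsplit (l := K) plE).
exact: same_link_trans ED DK.
Qed.

Theorem proposition4p6 (P : link -> {mpoly int[4]})
    (K K' L : link) :
  is_polynomial_invariant P ->
  alternating_link K -> alternating_link K' ->
  is_connected_sum K K' L ->
  P L = (P K * P K')%R.
Proof.
move=> hP [D [DK altD]] [D' [DK' altD']] [D1 [D1' [v1 [v1' [D1K D1K' sumL]]]]].
have pD := diagram_planar_connected DK; have pD' := diagram_planar_connected DK'.
have pD1 := diagram_planar_connected D1K; have pD1' := diagram_planar_connected D1K'.
have D1D : same_link D1 D := same_link_trans D1K.2 (same_link_sym DK.2).
have D1D' : same_link D1' D' := same_link_trans D1K'.2 (same_link_sym DK'.2).
have [v e1] := (sum_same_link v1' pD1' (diagram_nonsplit D1K.2) D1D).1 v1.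
(* The transfer changes the left summand, so the second one is treated in the reversed sum, and
   [same_link_sum_sym] links the two. *)
have [v' e2] := (sum_same_link v pD (diagram_nonsplit D1K'.2) D1D').1 v1'.
have [S0 chS0] := alternating_checkerboard (planar_separated pD.1) pD altD.
have [S' chS'] := alternating_checkerboard (planar_separated pD'.1) pD' altD'.
(* Besides sliding, this may exchange the shading of a crossingless diagram, so [S] replaces [S0]
   from here on. *)
have [k [S [chS matched]]] :=
  recolor_strand (planar_separated pD.1) v ((v', true) \in S') pD chS0.
set w := iter k (nxt D) v in matched.
have wL : same_link (diagram_sum w v') L.
  apply: same_link_trans sumL; apply: same_link_sym; apply: (same_link_trans e1).
  apply: (same_link_trans (same_link_sum_sym v v1' pD pD1')); apply: (same_link_trans e2).
  apply: (same_link_trans (same_link_sum_sym v' v pD' pD)).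
  exact: same_link_slide_iter.
have chSS := checkerboard_sum pD pD' chS chS' matched.
rewrite (@invariantE P L (diagram_sum w v') _ (inl w) hP (planar_sum w v' pD pD') wL chSS).
rewrite tree_polynomial_sum // -(invariantE w hP pD DK.2 chS).
by rewrite -(invariantE v' hP pD' DK'.2 chS').
Qed.
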